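(* Let $p\ge1$ be an integer. There exists $\varepsilon_p>0$ such that for all $0<\varepsilon<\varepsilon_p$ the function $u_{\varepsilon,2p}$ on $S^1$ has Allen--Cahn Morse index $2p-1$ and nullity $1$. The nullity is given by rotations of $S^1$, and every other non-trivial variation of the nodes produces a strictly negative second variation: for $f:\{\tfrac{i}{2p}\}_{i=0}^{2p-1}\to\mathbb R$ and $a_i(t)=\frac i{2p}+tf(\frac i{2p})$, one has $\frac{d^2}{dt^2}|_{t=0}\mathrm{BE}_\varepsilon(\{a_i(t)\})<0$ unless $f$ is constant.
   Context: $S^1\cong[0,1]$ with $0\sim1$. $W(u)=\frac{(1-u^2)^2}{4}$ and $E_\varepsilon(u,I)=\int_I\frac\varepsilon2|u'|^2+\frac1\varepsilon W(u)$. For all $\varepsilon$ sufficiently small (depending on $p$) there is a positive minimizer $u^+_{\varepsilon,2p}$ of $E_\varepsilon$ on $[0,\frac1{2p}]$ with zero Dirichlet conditions; $u_{\varepsilon,2p}$ is the solution of $\varepsilon^2u''=W'(u)$ on $S^1$ given by $u_{\varepsilon,2p}(x)=(-1)^iu^+_{\varepsilon,2p}(x-\frac{i}{2p})$ for $x\in[\frac i{2p},\frac{i+1}{2p}]$; it vanishes exactly at the $2p$ points $i/(2p)$. The Allen--Cahn Morse index of $u$ is the maximal dimension of a subspace of $W^{1,2}(S^1)$ on which $\int_{S^1}\varepsilon|\phi'|^2+\frac1\varepsilon W''(u)\phi^2$ is negative definite; the nullity is the dimension of the kernel of $\varepsilon^2\partial_x^2-W''(u)$ on $S^1$; ''given by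 rotations'' means this kernel is spanned by $\partial_xu_{\varepsilon,2p}$. For $2p$ points $a_0<\dots<a_{2p-1}$ on $S^1$, $\mathrm{BE}_\varepsilon(\{a_i\})$ is the sum over the $2p$ complementary intervals of the minimum of $E_\varepsilon$ on that interval among functions vanishing at its endpoints. *)

(* Defs.v *)
From HB Require Import structures.
From mathcomp Require Import all_boot all_order all_algebra.
From mathcomp Require Import all_classical all_reals all_analysis.
Set Implicit Arguments.
Unset Strict Implicit.
Unset Printing Implicit Defensive.
Import Order.TTheory GRing.Theory Num.Theory.
Import numFieldNormedType.Exports.
Local Open Scope classical_set_scope.
Local Open Scope ring_scope.

(* Functions on the circle S^1 = [0,1]/(0~1) are the 1-periodic functions
   R -> R. *)

(* A W^{1,2} function on an interval is identified with its absolutely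
   continuous representative, so that boundary values make sense and distinct
   functions on [a, b] are distinct elements of W^{1,2}. *)
Definition is_wderiv (R : realType) (a b : R) (u g : R -> R) : Prop :=
  [/\ measurable_fun `[a, b] g,
      (@lebesgue_measure R).-integrable `[a, b] (fun x => (g x ^+ 2)%:E) &
      forall x, x \in `[a, b] ->
        u x = u a + \int[@lebesgue_measure R]_(y in `[a, x]) g y].

Definition W12 (R : realType) (a b : R) : set (R -> R) :=
  [set u | exists g, is_wderiv a b u g].

(* The derivative of u in W^{1,2}(a, b); it is unique up to a null set, and is
   only used under integrals over [a, b]. *)
Definition wderiv (R : realType) (a b : R) (u : R -> R) : R -> R :=
  xget (cst 0) [set g | is_wderiv a b u g].

Definition W12_0 (R : realType) (a b : R) : set (R -> R) :=
  [set u | [/\ W12 a b u, u a = 0 & u b = 0]].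

(* Periodicity provides the matching condition u 0 = u 1 that characterizes
   W^{1,2}(S^1) inside W^{1,2}(0, 1). *)
Definition W12_circle (R : realType) : set (R -> R) :=
  [set u | periodic u 1 /\ W12 0 1 u].

Definition W (R : realType) (u : R) : R := (1 - u ^+ 2) ^+ 2 / 4.

Definition d2W (R : realType) : R -> R := derive1n 2 (@W R).

Definition energy (R : realType) (eps a b : R) (u : R -> R) : R :=
  \int[@lebesgue_measure R]_(x in `[a, b])
    (eps / 2 * wderiv a b u x ^+ 2 + eps^-1 * W (u x)).

Definition minimizers (R : realType) (eps a b : R) : set (R -> R) :=
  [set u | W12_0 a b u /\
           forall v, W12_0 a b v -> energy eps a b u <= energy eps a b v].

(* The image is a singleton as soon as a minimizer exists. *)
Definition min_energy (R : realType) (eps a b : R) : R :=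
  xget 0 (energy eps a b @` minimizers eps a b).

Definition positive_minimizer (R : realType) (eps L : R) (u : R -> R) : Prop :=
  minimizers eps 0 L u /\ forall x, x \in `]0, L[ -> 0 < u x.

(* For x in [i/2p, (i+1)/2p[ the floor below is i. It is defined on all of R
   and is 1-periodic because 2p is even; at a node the two adjacent formulas
   agree since up vanishes at 0 and 1/2p. *)
Definition u2p (R : realType) (p : nat) (up : R -> R) (x : R) : R :=
  let i : int := Num.floor (x * (2 * p)%:R) in
  (-1) ^ i * up (x - i%:~R / (2 * p)%:R).

Definition lin_comb (R : realType) (n : nat) (b : 'I_n -> R -> R)
    (c : 'I_n -> R) : R -> R :=
  fun x => \sum_(i < n) c i * b i x.

Definition has_dim (R : realType) (V : set (R -> R)) (n : nat) : Prop :=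
  exists b : 'I_n -> R -> R,
    (forall c, lin_comb b c = cst 0 -> forall i, c i = 0) /\
    V = range (lin_comb b).

Definition second_variation (R : realType) (eps : R) (u phi : R -> R) : R :=
  \int[@lebesgue_measure R]_(x in `[0, 1])
    (eps * wderiv 0 1 phi x ^+ 2 + eps^-1 * d2W (u x) * phi x ^+ 2).

Definition negative_definite (R : realType) (eps : R) (u : R -> R)
    (V : set (R -> R)) : Prop :=
  forall phi, V phi -> phi <> cst 0 -> second_variation eps u phi < 0.

(* An infinite-dimensional negative definite subspace would contain finite
   dimensional ones of every dimension, so it is excluded as well. *)
Definition morse_index (R : realType) (eps : R) (u : R -> R) (n : nat) : Prop :=
  (exists V, [/\ V `<=` @W12_circle R, negative_definite eps u V &
                 has_dim V n]) /\
  (forall V m, V `<=` @W12_circle R -> negative_definite eps u V ->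
               has_dim V m -> (m <= n)%N).

Definition twice_derivable (R : realType) (f : R -> R) (x : R) : Prop :=
  (\forall y \near x, derivable f y 1) /\ derivable (derive1 f) x 1.

Definition jacobi_kernel (R : realType) (eps : R) (u : R -> R) :
    set (R -> R) :=
  [set phi | [/\ periodic phi 1,
                 forall x, twice_derivable phi x &
                 forall x, eps ^+ 2 * derive1n 2 phi x - d2W (u x) * phi x
                           = 0]].

Definition nullity (R : realType) (eps : R) (u : R -> R) (n : nat) : Prop :=
  has_dim (jacobi_kernel eps u) n.

(* Right neighbour on the circle of the i-th of n cyclically ordered points
   a_0 < ... < a_{n-1} < a_0 + 1, lifted to R: the last point is followed by
   a_0 + 1. *)
Definition next_node (R : realType) (n : nat) (a : 'I_n -> R) (i : 'I_n) : R :=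
  a (ordS i) + (i.+1 == n)%:R.

Definition BE (R : realType) (eps : R) (n : nat) (a : 'I_n -> R) : R :=
  \sum_(i < n) min_energy eps (a i) (next_node a i).

Definition moved_nodes (R : realType) (p : nat) (f : 'I_(2 * p) -> R) (t : R) :
    'I_(2 * p) -> R :=
  fun i => i%:R / (2 * p)%:R + t * f i.

(* Main.v *)
(* Substituting u = sqrt (2 k) sin theta in eps^2 u'' = W'(u) gives the scalar
   equation eps theta' = sqrt (1 - k (1 + sin^2 theta)), solved by quadrature:
   u has its zeros at distance eps T(k), where T increases from pi to +oo on
   ]0, 1/2[. By Picone's inequality,
   E(v) - E(u) >= 1 / (4 eps) * \int (v^2 - u^2)^2 for all v in W^{1,2}_0, so u
     is
   the only positive minimizer; the same inequality makes the second variation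
   nonnegative on functions vanishing at the 2p nodes. As u' is in the kernel
   and does not vanish at the nodes, adding it to a negative definite subspace
   bounds the index by 2p - 1.
   The linearized equation is a Lame equation with the explicit second solution
   w = Z u' + (2 - 2 h) u - u^3, Z' = u^2 - 2 h < 0, h = 2 k - 2 k^2. Since Z is
   monotone, w is not periodic and the nullity is 1. The broken Jacobi fields
   moving the i-th node at speed F_i have second variation
   c * \sum_i (F_(i+1) - F_i)^2 with c < 0; those with F_0 = 0 form a negative
   definite subspace of dimension 2p - 1.
   Finally, comparing minimizers on intervals of nearby lengths l after
   rescaling, the least energy e(l) satisfies e'(l) = (1 - 2 k)^2 / (4 eps),
   which is strictly decreasing in l, and BE is the sum of the e(l_i). *)

Require Import Defs.
From mathcomp Require Import all_boot all_order all_algebra.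
From mathcomp Require Import all_classical all_reals all_analysis.
From mathcomp Require Import measurable_realfun ring lra.
Import Order.TTheory GRing.Theory Num.Theory.
Import numFieldNormedType.Exports.
Local Open Scope classical_set_scope.
Local Open Scope ring_scope.
Set Implicit Arguments.
Unset Strict Implicit.

(** No direct method is used: the minimizer is built from the differential equation. Picone's
    inequality for [u] as a positive solution of the linear equation [u'' = V u],
    [V = (u^2 - 1) / eps^2], then yields minimality and uniqueness together. Two obstacles shape
    that part. Since [u] vanishes at the ends of its interval, [u' / u] is replaced by
    [u' / (u + d)], and [d] tends to 0 by dominated convergence. And a competitor is only the
    integral of a square integrable function, so the product rule has to be derived from increments.
    The threshold is explicit: [eps T(k) = 1 / (2 p)] is solvable as soon as [pi eps < 1 / (2 p)].
    Both the period and the least energy are differentiated through two-sided bounds with quadratic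
    error. For the least energy a comparison gives an upper bound only; exchanging the two lengths
    makes it a lower one. The slope is the conserved quantity [W(u) / eps - eps u'^2 / 2 = (1 - 2
    k)^2 / (4 eps)] of the equation. *)

Section derivs.
Context {R : realType}.
Implicit Types (f g : R -> R) (x a b c : R).
Lemma derD f g x a b : is_derive x 1 f a -> is_derive x 1 g b ->
  is_derive x 1 (fun y => f y + g y) (a + b).
Proof. by move=> fa gb; exact: is_deriveD. Qed.
Lemma derB f g x a b : is_derive x 1 f a -> is_derive x 1 g b ->
  is_derive x 1 (fun y => f y - g y) (a - b).
Proof. by move=> fa gb; exact: is_deriveB. Qed.
Lemma derN f x a : is_derive x 1 f a -> is_derive x 1 (fun y => - f y) (- a).
Proof. by move=> fa; exact: is_deriveN. Qed.
Lemma derM f g x a b : is_derive x 1 f a -> is_derive x 1 g b ->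
  is_derive x 1 (fun y => f y * g y) (a * g x + f x * b).
Proof.
move=> fa gb; apply: is_derive_eq (is_deriveM fa gb) _.
by rewrite /GRing.scale /= addrC [g x * a]mulrC.
Qed.
Lemma derX f n x a : is_derive x 1 f a ->
  is_derive x 1 (fun y => f y ^+ n) (n%:R * f x ^+ n.-1 * a).
Proof.
by move=> fa; have := is_deriveX n fa; rewrite exprfctE.
Qed.
Lemma derC c x : is_derive x 1 (fun=> c) (0 : R).
Proof. exact: is_derive_cst. Qed.
Lemma derI x : is_derive x 1 (fun y => y) (1 : R).
Proof. exact: is_derive_id. Qed.
Lemma derV f x a : f x != 0 -> is_derive x 1 f a ->
  is_derive x 1 (fun y => (f y)^-1) (- (a / f x ^+ 2)).
Proof.
move=> f0 fa; apply: is_derive_eq (is_deriveV f0 fa) _.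
by rewrite /GRing.scale /= mulNr mulrC.
Qed.
Lemma der_comp f g x a b : is_derive (g x) 1 f a -> is_derive x 1 g b ->
  is_derive x 1 (fun y => f (g y)) (a * b).
Proof. by move=> fa gb; exact: (is_derive1_comp fa gb). Qed.
End derivs.

(** Hypotheses of the form [forall x, is_derive x 1 f _] serve as rules, which is why proofs copy
    such facts into the context before calling [der]. *)
Ltac der1 := match goal with
 | |- is_derive _ _ (fun _ => ?c) _ => notypeclasses refine (derC _ _)
 | |- is_derive _ _ (fun y => y) _ => notypeclasses refine (derI _)
 | |- is_derive _ _ (fun y => _ + _) _ => notypeclasses refine (derD _ _)
 | |- is_derive _ _ -%R _ => notypeclasses refine (derN (derI _))
 | |- is_derive _ _ ( *%R _) _ => notypeclasses refine (derM (derC _ _) (derI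
   _))
 | |- is_derive _ _ (+%R _) _ => notypeclasses refine (derD (derC _ _) (derI _))
 | |- is_derive _ _ (fun y => - _) _ => notypeclasses refine (derN _)
 | |- is_derive _ _ (fun y => _ * _) _ => notypeclasses refine (derM _ _)
 | |- is_derive _ _ (fun y => _ ^+ _) _ => notypeclasses refine (derX _ _)
 | |- is_derive _ _ (fun y => _^-1) _ => notypeclasses refine (derV _ _)
 | H : forall _, is_derive _ _ ?f _ |- is_derive _ _ (fun y => ?f y) _ =>
     notypeclasses refine (H _)
 | H : forall _, is_derive _ _ ?f _ |- is_derive _ _ ?f _ =>
     notypeclasses refine (H _)
 | H : forall _, is_derive _ _ ?f _ |- is_derive _ _ (fun y => ?f _) _ =>
     notypeclasses refine (der_comp (H _) _)
 end.
Ltac der := notypeclasses refine (is_derive_eq _ _); [repeat der1|rewrite /=].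

(** * Primitives of continuous functions and monotonicity *)

Section primitives.
Context {R : realType}.
Notation mu := (@lebesgue_measure R).
Implicit Types (f F : R -> R) (x a b c : R).

Lemma der_continuous f (df : R -> R) :
  (forall x, is_derive x 1 f (df x)) -> continuous f.
Proof.
move=> fd x; apply/differentiable_continuous/derivable1_diffP.
by have := fd x => -[].
Qed.

Lemma der_unique f x a b : is_derive x 1 f a -> is_derive x 1 f b -> a = b.
Proof. by move=> [_ <-] [_ <-]. Qed.

Lemma der_derive1 f x a : is_derive x 1 f a -> derive1 f x = a.
Proof. by move=> [_ <-]; rewrite derive1E. Qed.

Lemma der_eqfun f g x a : is_derive x 1 f a -> f =1 g -> is_derive x 1 g a.
Proof. by move=> + /funext <-. Qed.

Lemma continuous_integrable_itv f a b : continuous f ->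
  mu.-integrable `[a, b] (EFin \o f).
Proof.
move=> cf; apply: continuous_compact_integrable; first exact: segment_compact.
exact: continuous_subspaceT.
Qed.

Lemma Rintegral_chasles f a b c : a <= b -> b <= c ->
  mu.-integrable `[a, c] (EFin \o f) ->
  \int[mu]_(x in `[a, c]) f x =
  \int[mu]_(x in `[a, b]) f x + \int[mu]_(x in `[b, c]) f x.
Proof.
move=> ab bc fi.
have := @Rintegral_itvB R f (BLeft a) (BRight c) b fi.
rewrite !bnd_simp => /(_ ab bc).
rewrite Rintegral_itv_obnd_cbnd; last first.
  by apply: integrableS fi => //; move=> y /=;
    rewrite !in_itv/= => /andP[/ltW by_ ->]; rewrite (le_trans ab).
by move=> <-; rewrite addrC subrK.
Qed.

Lemma FTC_within f F a b : a <= b ->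
  (forall x, x \in `[a, b] -> is_derive x 1 F (f x)) ->
  {within `[a, b], continuous f} -> \int[mu]_(x in `[a, b]) f x = F b - F a.
Proof.
rewrite le_eqVlt => /predU1P[<-|ab] dF cf.
  by rewrite set_itv1 Rintegral_set1 subrr.
have cF x : x \in `[a, b] -> {for x, continuous F}.
  move=> xab; apply/differentiable_continuous/derivable1_diffP.
  by have [] := dF x xab.
rewrite /Rintegral (continuous_FTC2 ab cf (F := F))//.
  split.
  - by move=> x xab; have [] := dF x (subset_itv_oo_cc xab).
  - by apply/cvg_at_right_filter/cF; rewrite in_itv/= lexx ltW.
  - by apply/cvg_at_left_filter/cF; rewrite in_itv/= lexx ltW.
by move=> x xab; exact: der_derive1 (dF x (subset_itv_oo_cc xab)).
Qed.

Lemma FTC f F a b : a <= b -> (forall x, is_derive x 1 F (f x)) ->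
  continuous f -> \int[mu]_(x in `[a, b]) f x = F b - F a.
Proof.
move=> ab dF cf; apply: FTC_within => //; exact: continuous_subspaceT.
Qed.

Lemma primitive_exists f : continuous f ->
  exists2 F : R -> R, F 0 = 0 & forall x, is_derive x 1 F (f x).
Proof.
move=> cf; pose I a x := \int[mu]_(y in `[a, x]) f y.
have ch a b c : a <= b -> b <= c -> I a c = I a b + I b c.
  by move=> ab bc; apply: Rintegral_chasles => //;
    exact: continuous_integrable_itv.
(* An integral over [[a, x]] is 0 when [x < a], so the base point has to move with [x]; subtracting
   the value at 0 makes the result independent of it. *)
pose F x := I (- (`|x| + 1)) x - I (- (`|x| + 1)) 0.
have FE a x : a <= - (`|x| + 1) -> F x = I a x - I a 0.
  move=> ax; have h0 : - (`|x| + 1) <= 0 by have := normr_ge0 x; lra.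
  have hx : - (`|x| + 1) <= x by have := ler_norm (- x); rewrite normrN; lra.
  by rewrite /F (ch _ _ _ ax h0) (ch _ _ _ ax hx); ring.
exists F; first by rewrite /F subrr.
move=> x; pose a := - (`|x| + 2).
have ax : a < x by rewrite /a; have := ler_norm (- x); rewrite normrN; lra.
apply: (@near_eq_is_derive _ _ _ (fun y => I a y - I a 0)).
  near=> y; apply/esym/FE; rewrite /a.
  have : `|y - x| <= 1.
    by rewrite distrC; near: y; exists 1 => //= z /ltW.
  by have := ler_normD (y - x) x; rewrite subrK; lra.
have xx1 : x < x + 1 by rewrite ltrDl.
suff dI : is_derive x 1 (I a) (f x).
  by rewrite -[f x]subr0; apply: derB dI (derC _ _).
have [d e] := continuous_FTC1_closed xx1
  (continuous_integrable_itv a (x + 1) cf) ax (cf x).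
by rewrite -e derive1E; exact: derivableP.
Unshelve. all: by end_near. Qed.

Lemma der_nondecreasing f (df : R -> R) a b : a <= b ->
  (forall x, is_derive x 1 f (df x)) -> (forall x, a < x < b -> 0 <= df x) ->
  f a <= f b.
Proof.
rewrite le_eqVlt => /predU1P[<-//|ab] fd df0.
have [|c cab e] := @MVT R f df a b ab.
  exact/continuous_subspaceT/(der_continuous fd).
rewrite in_itv/= in cab.
by rewrite -subr_ge0 e mulr_ge0 ?df0// subr_ge0 ltW.
Qed.

Lemma der_increasing f (df : R -> R) a b : a < b ->
  (forall x, is_derive x 1 f (df x)) -> (forall x, a < x < b -> 0 < df x) ->
  f a < f b.
Proof.
move=> ab fd df0.
have [|c cab e] := @MVT R f df a b ab.
  exact/continuous_subspaceT/(der_continuous fd).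
rewrite in_itv/= in cab.
by rewrite -subr_gt0 e mulr_gt0 ?df0// subr_gt0.
Qed.

End primitives.

(** * Weak derivatives on an interval *)

Section square_integrable.
Context {R : realType}.
Notation mu := (@lebesgue_measure R).
Implicit Types (f g h u v F G : R -> R) (x a b c d : R).

Definition intg a b f : Prop := mu.-integrable `[a, b] (EFin \o f).

Definition sqint a b f : Prop :=
  measurable_fun `[a, b] f /\ intg a b (fun x => f x ^+ 2).

Definition cont a b f : Prop := {within `[a, b], continuous f}.

Lemma intgD a b f g : intg a b f -> intg a b g ->
  intg a b (fun x => f x + g x).
Proof. by move=> fi gi; exact: (integrableD _ fi gi). Qed.

Lemma intgB a b f g : intg a b f -> intg a b g ->
  intg a b (fun x => f x - g x).
Proof. by move=> fi gi; exact: (integrableB _ fi gi). Qed.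

Lemma intgZ a b f c : intg a b f -> intg a b (fun x => c * f x).
Proof. by move=> fi; exact: (integrableZl _ _ fi). Qed.

Lemma intg_norm a b f : intg a b f -> intg a b (fun x => `|f x|).
Proof. by move=> fi; exact: (integrable_norm fi). Qed.

Lemma intgS a b c d f : a <= c -> d <= b -> intg a b f -> intg c d f.
Proof.
move=> ac db; apply: integrableS => // x /=; rewrite !in_itv/=.
by move=> /andP[cx xd]; rewrite (le_trans ac cx) (le_trans xd db).
Qed.

Lemma intg_measurable a b f : intg a b f -> measurable_fun `[a, b] f.
Proof. by move=> /integrableP[mf _]; exact/measurable_EFinP. Qed.

Lemma intg_cont a b f : cont a b f -> intg a b f.
Proof.
by move=> cf; apply: continuous_compact_integrable cf; exact: segment_compact.
Qed.

Lemma cont_continuous a b f : continuous f -> cont a b f.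
Proof. by move=> cf; exact: continuous_subspaceT. Qed.

Lemma contS a b c d f : a <= c -> d <= b -> cont a b f -> cont c d f.
Proof.
move=> ac db; apply: continuous_subspaceW => x /=; rewrite !in_itv/=.
by move=> /andP[cx xd]; rewrite (le_trans ac cx) (le_trans xd db).
Qed.

Lemma contD a b f g : cont a b f -> cont a b g -> cont a b (fun x => f x + g x).
Proof. by move=> cf cg x; apply: cvgD; [exact: cf|exact: cg]. Qed.

Lemma contM a b f g : cont a b f -> cont a b g -> cont a b (fun x => f x * g x).
Proof. by move=> cf cg x; apply: cvgM; [exact: cf|exact: cg]. Qed.

Lemma contN a b f : cont a b f -> cont a b (fun x => - f x).
Proof. by move=> cf x; apply: cvgN; exact: cf. Qed.

Lemma contC a b c : cont a b (fun=> c).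
Proof. by move=> x; exact: cvg_cst. Qed.
Arguments contC : clear implicits.

Lemma contX a b f n : cont a b f -> cont a b (fun x => f x ^+ n).
Proof.
move=> cf; elim: n => [|n ih]; first exact: contC.
by under eq_fun do rewrite exprS; exact: contM.
Qed.
Arguments contX [a b f] n.

Lemma intg_dom a b f g : measurable_fun `[a, b] f -> intg a b g ->
  (forall x, x \in `[a, b] -> `|f x| <= g x) -> intg a b f.
Proof.
move=> mf gi fg; apply: le_integrable gi => //.
  exact/measurable_EFinP.
by move=> x xab; rewrite lee_fin (le_trans (fg x xab))// ler_norm.
Qed.

Lemma sqint_mul a b f g : sqint a b f -> sqint a b g ->
  intg a b (fun x => f x * g x).
Proof.
move=> [mf fi] [mg gi]; apply: (intg_dom _ (intgD fi gi)).
  exact: measurable_funM.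
move=> x _; rewrite normrM -(real_normK (num_real (f x))).
rewrite -(real_normK (num_real (g x))).
by have := sqr_ge0 (`|f x| - `|g x|); have := sqr_ge0 (`|f x| + `|g x|); nra.
Qed.

Lemma sqint_cont a b f : cont a b f -> sqint a b f.
Proof.
by move=> cf; split; [exact: (intg_measurable (intg_cont cf))|];
  apply: intg_cont; exact: contX.
Qed.

Lemma sqint_intg a b f : sqint a b f -> intg a b f.
Proof.
move=> fi; have := sqint_mul fi (sqint_cont (contC a b 1)).
by under eq_fun do rewrite mulr1.
Qed.

Lemma sqintD a b f g : sqint a b f -> sqint a b g ->
  sqint a b (fun x => f x + g x).
Proof.
move=> fi gi; split; first exact: measurable_funD fi.1 gi.1.
under eq_fun do rewrite sqrrD.
apply: intgD; last by case: gi.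
apply: intgD; first by case: fi.
by under eq_fun do rewrite -mulr_natl; apply: intgZ; exact: sqint_mul.
Qed.

Lemma sqintZ a b f c : sqint a b f -> sqint a b (fun x => c * f x).
Proof.
move=> [mf fi]; split; first exact: measurable_funM.
by under eq_fun do rewrite exprMn; exact: intgZ.
Qed.

Lemma sqintS a b c d f : a <= c -> d <= b -> sqint a b f -> sqint c d f.
Proof.
move=> ac db [mf fi]; split; last exact: intgS fi.
apply: measurable_funS mf => //= x /=; rewrite !in_itv/=.
by move=> /andP[cx xd]; rewrite (le_trans ac cx) (le_trans xd db).
Qed.

Lemma cont_bounded a b f : cont a b f ->
  exists2 M, 0 < M & forall x, x \in `[a, b] -> `|f x| <= M.
Proof.
move=> cf.
have /compact_bounded[M [_ mrt]] := continuous_compact cf (@segment_compact R a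
  b).
exists (`|M| + 1); first by rewrite ltr_wpDl.
move=> x xab; apply: (mrt (`|M| + 1)); last by exists x.
by rewrite (le_lt_trans (ler_norm M))// ltrDl.
Qed.

Lemma sqint_contM a b f g : cont a b f -> sqint a b g ->
  sqint a b (fun x => f x * g x).
Proof.
move=> cf gi; have [M M0 fM] := cont_bounded cf.
have mf : measurable_fun `[a, b] f by case: (sqint_cont cf).
have mfg : measurable_fun `[a, b] (fun x => f x * g x).
  by apply: measurable_funM => //; case: gi.
split => //; apply: (intg_dom _ (intgZ (M ^+ 2) gi.2)).
  exact: measurable_funX.
move=> x /fM fx; rewrite ger0_norm ?sqr_ge0// exprMn.
rewrite ler_wpM2r ?sqr_ge0// -(real_normK (num_real (f x))).
by rewrite ler_sqr ?nnegrE ?(ltW M0).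
Qed.

Lemma RintD a b f g : intg a b f -> intg a b g ->
  \int[mu]_(x in `[a, b]) (f x + g x) =
  \int[mu]_(x in `[a, b]) f x + \int[mu]_(x in `[a, b]) g x.
Proof. by move=> fi gi; rewrite RintegralD. Qed.

Lemma RintB a b f g : intg a b f -> intg a b g ->
  \int[mu]_(x in `[a, b]) (f x - g x) =
  \int[mu]_(x in `[a, b]) f x - \int[mu]_(x in `[a, b]) g x.
Proof. by move=> fi gi; rewrite RintegralB. Qed.

Lemma RintZ a b f c : intg a b f ->
  \int[mu]_(x in `[a, b]) (c * f x) = c * \int[mu]_(x in `[a, b]) f x.
Proof. by move=> fi; rewrite RintegralZl. Qed.

Lemma le_Rint a b f g : intg a b f -> intg a b g ->
  (forall x, x \in `[a, b] -> f x <= g x) ->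
  \int[mu]_(x in `[a, b]) f x <= \int[mu]_(x in `[a, b]) g x.
Proof. by move=> fi gi fg; apply: le_Rintegral. Qed.

Lemma eq_Rint a b f g : (forall x, x \in `[a, b] -> f x = g x) ->
  \int[mu]_(x in `[a, b]) f x = \int[mu]_(x in `[a, b]) g x.
Proof. by move=> fg; apply: eq_Rintegral => x; rewrite inE => /fg. Qed.

Lemma norm_Rint a b f : intg a b f ->
  `|\int[mu]_(x in `[a, b]) f x| <= \int[mu]_(x in `[a, b]) `|f x|.
Proof. by move=> fi; apply: le_normr_Rintegral. Qed.

Lemma cont_integral a b f : a <= b -> intg a b f ->
  cont a b (fun x => \int[mu]_(y in `[a, x]) f y).
Proof. by move=> ab fi; exact: parameterized_integral_continuous. Qed.

Lemma eq_cont a b f g : (forall x, x \in `[a, b] -> f x = g x) ->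
  cont a b f -> cont a b g.
Proof.
by move=> fg; apply: subspace_eq_continuous => x; rewrite inE => /fg.
Qed.

(* Bisecting at the midpoint of the values of [Phi] halves the bound. *)
Lemma quadratic_increments_cst a b (H Phi : R -> R) : a <= b -> cont a b Phi ->
  (forall c d, a <= c -> c <= d -> d <= b ->
     Phi c <= Phi d /\ `|H d - H c| <= (Phi d - Phi c) ^+ 2) ->
  H b = H a.
Proof.
move=> ab cP hH.
have key n : forall c d, a <= c -> c <= d -> d <= b ->
    `|H d - H c| <= (Phi d - Phi c) ^+ 2 / 2 ^+ n.
  elim: n => [|n ih] c d ac cd db; first by rewrite divr1; case: (hH c d).
  have [Pcd _] := hH c d ac cd db.
  have [|e] := @IVT R Phi c d ((Phi c + Phi d) / 2) cd (contS ac db cP).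
    by rewrite ge_min le_max; apply/andP; split; apply/orP; [left|right]; lra.
  rewrite in_itv/= => /andP[ce ed] Pe.
  have h1 := ih _ _ ac ce (le_trans ed db).
  have h2 := ih _ _ (le_trans ac ce) ed db.
  have -> : H d - H c = (H d - H e) + (H e - H c) by ring.
  rewrite (le_trans (ler_normD _ _))// (le_trans (lerD h2 h1))//.
  rewrite Pe [2 ^+ n.+1]exprS invfM le_eqVlt; apply/orP; left; apply/eqP.
  by field.
apply/eqP; rewrite -subr_eq0 -normr_le0; apply/ler_addgt0Pl => e e0.
rewrite addr0; set X := (Phi b - Phi a) ^+ 2.
have [n] : exists n : nat, X / e < 2 ^+ n.
  exists (Num.truncn (X / e)).+1.
  rewrite (lt_le_trans (truncnS_gt _))// -natrX ler_nat.
  by rewrite ltnW// ltn_expl.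
rewrite ltr_pdivrMr// => Xn.
by rewrite (le_trans (key n a b _ _ _))// ler_pdivrMr ?exprn_gt0// mulrC ltW.
Qed.

End square_integrable.
Arguments contC {R} a b c.
Arguments contX {R} [a b f] n.

(** * Product rule and uniqueness for weak derivatives *)

Section weak_derivatives.
Context {R : realType}.
Notation mu := (@lebesgue_measure R).
Implicit Types (f g h u v F G : R -> R) (x a b c d : R).

Lemma wd_sqint a b u g : is_wderiv a b u g -> sqint a b g.
Proof. by case. Qed.

Lemma wd_incr a b u g c d : is_wderiv a b u g -> a <= c -> c <= d -> d <= b ->
  u d - u c = \int[mu]_(x in `[c, d]) g x.
Proof.
move=> [mg gi ug] ac cd db; have /sqint_intg ig : sqint a b g by [].
rewrite (ug d) ?in_itv/= ?db ?(le_trans ac)// (ug c) ?in_itv/= ?ac ?(le_trans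
  cd)//.
rewrite (Rintegral_chasles ac cd); last exact: (intgS (lexx _) db ig).
by ring.
Qed.

Lemma wdS a b u g c d : is_wderiv a b u g -> a <= c -> d <= b ->
  is_wderiv c d u g.
Proof.
move=> ug ac db; have [mg gi] := sqintS ac db (wd_sqint ug).
split => // x; rewrite in_itv/= => /andP[cx xd].
by rewrite -(wd_incr ug ac cx (le_trans xd db)); ring.
Qed.

Lemma wd_cont a b u g : a <= b -> is_wderiv a b u g -> cont a b u.
Proof.
move=> ab ug; have ig := sqint_intg (wd_sqint ug).
apply: (@eq_cont _ _ _ (fun x => u a + \int[mu]_(y in `[a, x]) g y)).
  by move=> x xab; case: ug => _ _ /(_ _ xab).
exact: (contD (contC a b _) (cont_integral ab ig)).
Qed.

Lemma wd_C1_within a b u g :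
  (forall x, x \in `[a, b] -> is_derive x 1 u (g x)) -> cont a b g ->
  is_wderiv a b u g.
Proof.
move=> ug cg; have [mg ig] := sqint_cont cg.
split => // x; rewrite in_itv/= => /andP[ax xb].
have dux y : y \in `[a, x] -> is_derive y 1 u (g y).
  rewrite in_itv/= => /andP[ay yx]; apply: ug.
  by rewrite in_itv/= ay (le_trans yx).
by rewrite (FTC_within ax dux (contS (lexx _) xb cg)); ring.
Qed.

Lemma wd_C1 a b u g : (forall x, is_derive x 1 u (g x)) -> continuous g ->
  is_wderiv a b u g.
Proof. by move=> ug cg; apply: wd_C1_within => //; exact: cont_continuous. Qed.

Lemma wdD a b u v f g : is_wderiv a b u f -> is_wderiv a b v g ->
  is_wderiv a b (fun x => u x + v x) (fun x => f x + g x).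
Proof.
move=> uf vg; have [m i] := sqintD (wd_sqint uf) (wd_sqint vg).
split => // x; rewrite in_itv/= => /andP[ax xb].
have fi := intgS (lexx _) xb (sqint_intg (wd_sqint uf)).
have gi := intgS (lexx _) xb (sqint_intg (wd_sqint vg)).
by rewrite RintD// -(wd_incr uf _ ax xb)// -(wd_incr vg _ ax xb)//; ring.
Qed.

Lemma wdZ a b u f c : is_wderiv a b u f ->
  is_wderiv a b (fun x => c * u x) (fun x => c * f x).
Proof.
move=> uf; have [m i] := sqintZ c (wd_sqint uf).
split => // x; rewrite in_itv/= => /andP[ax xb].
have fi := intgS (lexx _) xb (sqint_intg (wd_sqint uf)).
by rewrite RintZ// -(wd_incr uf _ ax xb)//; ring.
Qed.

Lemma wd_eq a b u v g : (forall x, x \in `[a, b] -> u x = v x) -> a <= b ->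
  is_wderiv a b u g -> is_wderiv a b v g.
Proof.
move=> uv ab [mg gi ug]; split=> // x xab.
have aab : a \in `[a, b] by rewrite in_itv/= lexx.
by rewrite -(uv x xab) -(uv a aab); exact: ug.
Qed.

Lemma intg_glue a b c f : a <= b -> b <= c ->
  intg a b f -> intg b c f -> intg a c f.
Proof.
move=> ab bc i1 i2.
have acE : `[a, c]%classic = `[a, b] `|` `]b, c].
  apply/seteqP; split => x /=; rewrite !in_itv/=.
    move=> /andP[ax xc]; have [xb|bx] := leP x b; [left|right] => //.
    by rewrite ax.
  move=> [|] /andP[l r]; first by rewrite l (le_trans r).
  by rewrite r (le_trans ab (ltW l)).
have {}i2 : mu.-integrable `]b, c] (EFin \o f).
  by apply: integrableS i2 => //; exact: subset_itv_oc_cc.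
have [/integrableP[m1 l1] /integrableP[m2 l2]] := (i1, i2).
apply/integrableP; split.
  by rewrite acE; apply/measurable_funU.
rewrite acE ge0_integral_setU//; first exact: lte_add_pinfty.
- by apply: measurableT_comp => //; apply/measurable_funU.
- apply/disj_setPS => y [/=]; rewrite 2!in_itv/= => /andP[_ yx] /andP[].
  by rewrite ltNge yx.
Qed.

Lemma wd_glue a b c u g : a <= b -> b <= c ->
  is_wderiv a b u g -> is_wderiv b c u g -> is_wderiv a c u g.
Proof.
move=> ab bc u1 u2; have ac := le_trans ab bc.
have [s1 s2] := (wd_sqint u1, wd_sqint u2).
have ig := intg_glue ab bc (sqint_intg s1) (sqint_intg s2).
split; first exact: intg_measurable ig.
  exact: (intg_glue ab bc s1.2 s2.2).
move=> x; rewrite in_itv/= => /andP[ax xc].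
have [xb|/ltW bx] := leP x b.
  by rewrite -(wd_incr u1 _ ax xb)//; ring.
rewrite (Rintegral_chasles ab bx (intgS _ _ ig))//.
by rewrite -(wd_incr u1 _ ab)// -(wd_incr u2 _ bx)//; ring.
Qed.

(** With [H] the difference of the two sides up to a variable endpoint, the increment of [H] over
    [[c, d]] is at most the square of the integral of [|f| + |g|] there. Being of second order in an
    additive quantity, it forces [H] to be constant. *)
Lemma wd_mul_end a b u v f g : a <= b -> is_wderiv a b u f ->
  is_wderiv a b v g ->
  u b * v b - u a * v a = \int[mu]_(x in `[a, b]) (u x * g x + f x * v x).
Proof.
move=> ab uf vg.
have [cu cv] := (wd_cont ab uf, wd_cont ab vg).
have [sf sg] := (wd_sqint uf, wd_sqint vg).
have iug := sqint_mul (sqint_cont cu) sg.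
have ifv := sqint_mul sf (sqint_cont cv).
have ih := intgD iug ifv.
pose I F c d := \int[mu]_(x in `[c, d]) F x.
pose n x := `|f x| + `|g x|.
have inn : intg a b n by apply: intgD; apply: intg_norm; exact: sqint_intg.
pose H x := u x * v x - I (fun x => u x * g x + f x * v x) a x.
suff : H b = H a.
  rewrite /H /I set_itv1 Rintegral_set1 subr0 => e.
  by rewrite -e; ring.
apply: (@quadratic_increments_cst _ a b H (fun x => I n a x)) => //.
  exact: cont_integral.
move=> c d ac cd db.
have chas F : intg a b F -> I F a d - I F a c = I F c d.
  move=> iF; rewrite /I (@Rintegral_chasles _ F a c d)//; first by ring.
  exact: intgS db iF.
have n0 F : I (fun x => `|F x|) c d >= 0 by exact: Rintegral_ge0.
have int_cd := @intgS _ a b c d.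
have In : I n a d - I n a c = I (fun x => `|f x|) c d + I (fun x => `|g x|) c d.
  rewrite chas// /I /n RintD//; apply: int_cd => //; apply: intg_norm;
    exact: sqint_intg.
split.
  by rewrite -subr_ge0 In addr_ge0.
have [iF iG] : intg c d f /\ intg c d g.
  by split; apply: (intgS ac db); exact: sqint_intg.
have part F : intg c d F -> forall s t, c <= s -> s <= t -> t <= d ->
    `|I F s t| <= I (fun x => `|F x|) c d.
  move=> iF' s t cs st td; have iF'' := intg_norm iF'.
  apply: (le_trans (norm_Rint (intgS cs td iF'))).
  rewrite /I (Rintegral_chasles cs (le_trans st td) iF'').
  rewrite (Rintegral_chasles st td (intgS cs (lexx _) iF'')).
  by rewrite addrCA lerDl addr_ge0//; exact: Rintegral_ge0.
set D := _ - I n a c.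
have Iu t : t \in `[c, d] -> `|u d - u t| <= D.
  rewrite in_itv/= => /andP[ct td].
  rewrite (wd_incr uf (le_trans ac ct) td db) /D In.
  by rewrite (le_trans (part _ iF _ _ ct td _))// lerDl.
have Iv t : t \in `[c, d] -> `|v c - v t| <= D.
  rewrite in_itv/= => /andP[ct td]; rewrite distrC.
  rewrite (wd_incr vg ac ct (le_trans td db)) /D In.
  by rewrite (le_trans (part _ iG _ _ _ ct td))// lerDr.
(* The integral of [u d * g + v c * f] over [[c, d]] is exactly [u d * v d - u c * v c], so [K] is
   the error; its coefficients are increments of [u] and [v], bounded by [D]. *)
pose K t := (u d * g t + v c * f t) - (u t * g t + f t * v t).
have iK1 : intg c d (fun t => u d * g t + v c * f t).
  by apply: intgD; exact: intgZ.
have iK2 := intgS ac db ih.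
have iK : intg c d K by apply: intgB.
have HK : H d - H c = I K c d.
  rewrite /I /K RintB// RintD//; last 2 first.
  - exact: intgZ.
  - exact: intgZ.
  rewrite !RintZ// -(wd_incr vg)// -(wd_incr uf)// /H.
  by rewrite -[X in _ = _ - X](chas _ ih) /I; ring.
have iB : intg c d (fun t => D * (`|f t| + `|g t|)).
  by apply/intgZ/intgD; exact: intg_norm.
rewrite HK (le_trans (norm_Rint iK))//.
rewrite (_ : D ^+ 2 = I (fun t => D * (`|f t| + `|g t|)) c d); last first.
  rewrite /I RintZ; last by apply: intgD; exact: intg_norm.
  by rewrite expr2 {2}/D In RintD//; exact: intg_norm.
apply: le_Rint => //; first exact: intg_norm.
move=> t tcd; have -> : K t = (u d - u t) * g t + (v c - v t) * f t.
  by rewrite /K; ring.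
rewrite (le_trans (ler_normD _ _))// !normrM mulrDr addrC.
by rewrite lerD// ler_wpM2r// ?Iu ?Iv.
Qed.

Lemma wd_mul a b u v f g : a <= b -> is_wderiv a b u f -> is_wderiv a b v g ->
  is_wderiv a b (fun x => u x * v x) (fun x => u x * g x + f x * v x).
Proof.
move=> ab uf vg; have [cu cv] := (wd_cont ab uf, wd_cont ab vg).
have := sqintD (sqint_contM cu (wd_sqint vg)) (sqint_contM cv (wd_sqint uf)).
rewrite (_ : (fun x => u x * g x + v x * f x) =
             (fun x => u x * g x + f x * v x)); last first.
  by apply/funext => x; rewrite [v x * _]mulrC.
move=> [m i]; split => // x; rewrite in_itv/= => /andP[ax xb].
rewrite -(wd_mul_end ax); first by ring.
- exact: (wdS uf (lexx _) xb).
- exact: (wdS vg (lexx _) xb).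
Qed.

(** Lebesgue differentiation: almost everywhere [k] is the derivative of its primitive, here the
    zero function on []a, b[]. Extending [k] by zero makes it integrable on the whole line. *)
Lemma integral_eq0_ae a b k : intg a b k ->
  (forall x, x \in `[a, b] -> \int[mu]_(y in `[a, x]) k y = 0) ->
  {ae mu, forall x, x \in `[a, b] -> k x = 0}.
Proof.
move=> ik k0; pose e := k \_ `[a, b].
have ie : mu.-integrable setT (EFin \o e).
  rewrite (_ : EFin \o e = (EFin \o k) \_ `[a, b]); last first.
    by rewrite restrict_EFin.
  by apply/(integrable_mkcond _ _).1.
have le : locally_integrable [set: R] e by apply: integrable_locally.
have eT y : mu.-integrable [set` Interval (BLeft a) (BRight y)] (EFin \o e).
  by apply: integrableS ie.
have na c : {ae mu, forall x, x != c}.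
  exists [set c]; split => //; first exact: lebesgue_measure_set1.
  by move=> x /= /negP; rewrite negbK => /eqP.
have aeF := ae_filter_ringOfSetsType mu.
have := FTC1 eT le.
apply: filterS3 (na a) (na b) => x xa xb /= hx.
rewrite in_itv/= => /andP[ax bx].
have {}ax : a < x by rewrite lt_neqAle eq_sym xa.
have {}bx : x < b by rewrite lt_neqAle xb.
have [_] := hx ax; rewrite /e patchE mem_set; last first.
  by rewrite /= in_itv/= !ltW.
move=> <-; apply: der_derive1.
apply: (@near_eq_is_derive _ _ _ (fun=> 0)).
near=> y.
have yab : y \in `]a, b[.
  by near: y; apply: near_in_itvoo; rewrite in_itv/= ax.
rewrite in_itv/= in yab; case/andP: yab => ay yb.
rewrite -[LHS](k0 y) ?in_itv/= ?ltW//.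
apply: eq_Rint => t; rewrite in_itv/= => /andP[at_ ty].
by rewrite patchE mem_set//= in_itv/= at_ (le_trans ty (ltW yb)).
Unshelve. all: by end_near. Qed.

Lemma wd_unique_ae a b u f g : is_wderiv a b u f -> is_wderiv a b u g ->
  {ae mu, forall x, x \in `[a, b] -> f x = g x}.
Proof.
move=> uf ug.
have [fi gi] := (sqint_intg (wd_sqint uf), sqint_intg (wd_sqint ug)).
have := @integral_eq0_ae a b (fun x => f x - g x) (intgB fi gi).
have h x : x \in `[a, b] -> \int[mu]_(y in `[a, x]) (f y - g y) = 0.
  rewrite in_itv/= => /andP[ax xb].
  rewrite RintB; [|exact: intgS fi|exact: intgS gi].
  by rewrite -(wd_incr uf _ ax xb)// -(wd_incr ug _ ax xb)// subrr.
have aeF := ae_filter_ringOfSetsType mu.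
by move=> /(_ h); apply: filterS => x /= + xab => /(_ xab) /eqP;
  rewrite subr_eq0 => /eqP.
Qed.

(** [wderiv] is picked by choice; this lets any known weak derivative replace it inside the energy
    and the second variation. *)
Lemma wd_unique_Rint a b u f g c h : is_wderiv a b u f -> is_wderiv a b u g ->
  measurable_fun `[a, b] h ->
  \int[mu]_(x in `[a, b]) (c * f x ^+ 2 + h x) =
  \int[mu]_(x in `[a, b]) (c * g x ^+ 2 + h x).
Proof.
move=> uf ug mh; congr fine; apply: ae_eq_integral => //.
- apply/measurable_EFinP/measurable_funD => //; apply: measurable_funM => //.
  by apply: measurable_funX; case: uf.
- apply/measurable_EFinP/measurable_funD => //; apply: measurable_funM => //.
  by apply: measurable_funX; case: ug.
have aeF := ae_filter_ringOfSetsType mu.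
by have := wd_unique_ae uf ug; apply: filterS => x /= + xab => /(_ xab) ->.
Qed.

Lemma wderivP a b u g : is_wderiv a b u g -> is_wderiv a b u (wderiv a b u).
Proof. by move=> ug; apply: xgetPex; exists g. Qed.

Lemma cont_W u a b : cont a b u -> cont a b (fun x => W (u x)).
Proof.
move=> cu; rewrite /W; apply: contM (contC _ _ _).
exact/contX/(contD (contC _ _ _))/contN/contX.
Qed.

Lemma energyE (eps : R) a b u g : a <= b -> is_wderiv a b u g ->
  energy eps a b u =
  \int[mu]_(x in `[a, b]) (eps / 2 * g x ^+ 2 + eps^-1 * W (u x)).
Proof.
move=> ab ug; apply: (wd_unique_Rint _ (wderivP ug) ug).
apply: measurable_funM => //.
apply: intg_measurable; apply: intg_cont; apply: cont_W; exact: (wd_cont _ ug).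
Qed.

Lemma d2WE : @d2W R = fun x => 3 * x ^+ 2 - 1.
Proof.
have d1 x : is_derive x 1 (@W R) (x ^+ 3 - x).
  by rewrite /W; der => /=; field.
rewrite /d2W derive1nS derive1n1.
rewrite (_ : derive1 (@W R) = fun x => x ^+ 3 - x); last first.
  by apply/funext => x; exact: der_derive1.
by apply/funext => x; apply: der_derive1; der => /=; ring.
Qed.

Lemma second_variationE (eps : R) u phi g :
  cont 0 1 u -> is_wderiv 0 1 phi g ->
  second_variation eps u phi =
  \int[mu]_(x in `[0, 1])
    (eps * g x ^+ 2 + eps^-1 * (3 * u x ^+ 2 - 1) * phi x ^+ 2).
Proof.
move=> cu ug; rewrite /second_variation d2WE.
apply: (wd_unique_Rint _ (wderivP ug) ug).
apply: intg_measurable; apply: intg_cont; apply: contM; last first.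
  by apply: contX; exact: (wd_cont _ ug).
apply: contM (contC _ _ _) _; apply: contD (contC _ _ _).
exact/contM/contX/cu/contC.
Qed.

End weak_derivatives.

(** * Picone's inequality and minimality *)

Section picone.
Context {R : realType}.
Notation mu := (@lebesgue_measure R).
Implicit Types (f g h u v F G V q : R -> R) (x a b c d L eps k : R).

Lemma contV a b f : (forall x, x \in `[a, b] -> f x != 0) -> cont a b f ->
  cont a b (fun x => (f x)^-1).
Proof.
move=> f0 /subspace_continuousP cf; apply/subspace_continuousP => x xab.
by apply: cvgV; [exact: f0|exact: cf].
Qed.

(** Dominated convergence along [d = 1 / (n + 1)]: the integrand is at most 1 and tends to 0
    wherever [u] is positive, that is, off the two endpoints. *)
Lemma regularization_vanishes a b u : cont a b u ->
  (forall x, x \in `[a, b] -> 0 <= u x) ->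
  (forall x, a < x < b -> 0 < u x) -> forall e, 0 < e ->
  exists2 d, 0 < d & \int[mu]_(x in `[a, b]) (d / (u x + d)) < e.
Proof.
move=> cu u0 u1 e e0.
pose h (n : nat) := @harmonic R n.
pose f (n : nat) x := h n / (u x + h n).
have h0 n : 0 < h n by exact: harmonic_gt0.
have uh n x : x \in `[a, b] -> 0 < u x + h n by move=> /u0 ux; rewrite ltr_wpDl.
have cf n : cont a b (f n).
  apply: contM (contC _ _ _) _; apply: contV (contD cu (contC _ _ _)) => x xab.
  by rewrite gt_eqF ?uh.
have [//||||||_ _] := @dominated_convergence _ _ _ mu `[a, b] _
  (fun n => EFin \o f n) (cst 0%E) (cst 1%E).
- by move=> n; apply/measurable_EFinP; apply: intg_measurable; exact: intg_cont.
- exact: measurable_cst.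
- have na c : {ae mu, forall x, x != c}.
    exists [set c]; split => //; first exact: lebesgue_measure_set1.
    by move=> x /= /negP; rewrite negbK => /eqP.
  have aeF := ae_filter_ringOfSetsType mu.
  apply: filterS2 (na a) (na b) => x xa xb /=; rewrite in_itv/= => /andP[ax bx].
  have {}ax : a < x by rewrite lt_neqAle eq_sym xa.
  have {}bx : x < b by rewrite lt_neqAle xb.
  have ux : 0 < u x by apply: u1; rewrite ax.
  apply: cvg_EFin; first by apply: nearW.
  rewrite -[X in _ --> X](mul0r (u x + 0)^-1).
  apply: cvgM; first exact: cvg_harmonic.
  apply: cvgV; first by rewrite addr0 gt_eqF.
  by apply: cvgD; [exact: cvg_cst|exact: cvg_harmonic].
- by have := intg_cont (contC a b (1 : R)).
- apply: aeW => x n xab /=; have uhx := uh n x xab.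
  have fn0 : 0 <= f n x by rewrite divr_ge0// ltW.
  by rewrite lee_fin ger0_norm// /f ler_pdivrMr// mul1r lerDr u0.
rewrite integral0 => /fine_cvg /cvgr_lt /(_ e e0)[n _ /(_ n (leqnn n)) /= ne].
by exists (h n).
Qed.

(** With [q = u' / (u + d)], the difference of the integrands minus [(q v^2)'] is the square
    [(g - q v)^2], and [q v^2] vanishes at both ends. The shift by [d] keeps [q] regular where [u]
    vanishes. *)
Lemma picone_regularized a b u u1 V v g d : a <= b -> 0 < d ->
  (forall x, is_derive x 1 u (u1 x)) ->
  (forall x, is_derive x 1 u1 (V x * u x)) -> continuous V ->
  (forall x, x \in `[a, b] -> 0 <= u x) ->
  is_wderiv a b v g -> v a = 0 -> v b = 0 ->
  cont a b (fun x => (u x + d)^-1) ->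
  \int[mu]_(x in `[a, b]) (V x * v x ^+ 2 * (d / (u x + d))) <=
  \int[mu]_(x in `[a, b]) (g x ^+ 2 + V x * v x ^+ 2).
Proof.
move=> ab d0 du du1 cV u0 vg va vb ci.
have s0 x : x \in `[a, b] -> u x + d != 0.
  by move=> /u0 ux; rewrite gt_eqF// ltr_wpDl.
pose q x := u1 x * (u x + d)^-1.
pose q1 x := V x * u x * (u x + d)^-1 + u1 x * - (u1 x * ((u x + d)^-1 * (u x +
  d)^-1)).
have cu : cont a b u by apply/cont_continuous/der_continuous.
have cu1 : cont a b u1 by apply/cont_continuous/der_continuous.
have cVab : cont a b V by exact: cont_continuous.
have dq x : x \in `[a, b] -> is_derive x 1 q (q1 x).
  move=> /s0 ux; rewrite /q; der => //=.
  by rewrite /q1 addr0; field.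
have cq1 : cont a b q1.
  apply: contD; first by apply: (contM _ ci); exact: contM.
  by apply: (contM cu1); apply: contN; apply: (contM cu1); exact: contM.
have wq := wd_C1_within dq cq1.
have cv := wd_cont ab vg.
have := wd_mul ab wq (wd_mul ab vg vg).
set K := (X in is_wderiv _ _ _ X) => wK.
have : \int[mu]_(x in `[a, b]) K x = 0.
  by rewrite -(wd_incr wK) ?lexx//= va vb !(mulr0, mul0r) subrr.
have iK := sqint_intg (wd_sqint wK).
have iVv : intg a b (fun x => V x * v x ^+ 2).
  by apply: intg_cont; apply: contM => //; exact: contX.
have ig : intg a b (fun x => g x ^+ 2 + V x * v x ^+ 2).
  by apply: intgD => //; case: (wd_sqint vg).
have iV : intg a b (fun x => V x * v x ^+ 2 * (d / (u x + d))).
  apply: intg_cont; apply: contM; last by apply: contM ci; exact: contC.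
  by apply: contM => //; exact: contX.
move=> K0; rewrite -subr_ge0.
rewrite (_ : _ - _ = \int[mu]_(x in `[a, b]) (g x - q x * v x) ^+ 2).
  by apply: Rintegral_ge0 => x _; exact: sqr_ge0.
rewrite -[LHS]subr0 -K0 -RintB// -RintB//; last exact: intgB.
apply: eq_Rint => x /s0 ux.
by rewrite /K /q /q1; field.
Qed.

Lemma picone a b u u1 V v g : a <= b ->
  (forall x, is_derive x 1 u (u1 x)) ->
  (forall x, is_derive x 1 u1 (V x * u x)) -> continuous V ->
  (forall x, x \in `[a, b] -> 0 <= u x) ->
  (forall x, a < x < b -> 0 < u x) ->
  is_wderiv a b v g -> v a = 0 -> v b = 0 ->
  0 <= \int[mu]_(x in `[a, b]) (g x ^+ 2 + V x * v x ^+ 2).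
Proof.
move=> ab du du1 cV u0 upos vg va vb.
have cu : cont a b u by apply/cont_continuous/der_continuous.
have cVv : cont a b (fun x => V x * v x ^+ 2).
  by apply: contM; [exact: cont_continuous|apply: contX; exact: wd_cont vg].
have [M M0 bM] := cont_bounded cVv.
apply/ler_addgt0Pl => e e0.
(* As [|V v^2| <= M], this [d] makes the left side of the regularized inequality at least [- e]. *)
have [d d0 hd] := regularization_vanishes cu u0 upos (divr_gt0 e0 M0).
have ud x : x \in `[a, b] -> 0 < u x + d by move=> /u0 ux; rewrite ltr_wpDl.
have ci : cont a b (fun x => (u x + d)^-1).
  by apply: contV (contD cu (contC _ _ _)) => x xab; rewrite gt_eqF ?ud.
have cd : cont a b (fun x => d / (u x + d)) by apply: (contM (contC _ _ _)).
rewrite -lerBlDl sub0r.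
apply: le_trans (picone_regularized ab d0 du du1 cV u0 vg va vb ci).
rewrite (@le_trans _ _ (\int[mu]_(x in `[a, b]) (- M * (d / (u x + d)))))//.
  rewrite RintZ; last exact: intg_cont.
  by rewrite mulNr lerN2 mulrC -ler_pdivlMr// ltW.
apply: le_Rint.
- by apply: intgZ; exact: intg_cont.
- by apply: intg_cont; exact: contM.
move=> x xab; rewrite ler_wpM2r//; first by rewrite divr_ge0// ltW// ud.
by have := bM x xab; rewrite ler_norml => /andP[].
Qed.

End picone.

(** * Minimality of a profile and uniqueness of the positive minimizer *)

Section profiles.
Context {R : realType}.
Notation mu := (@lebesgue_measure R).
Implicit Types (f g h u v F G V q : R -> R) (x a b c d L eps k : R).

(* The solution with amplitude [Num.sqrt (2 * k)] and half-period [L]. *)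
Record profile eps k L u u1 : Prop := Profile {
  prof_eps : 0 < eps;
  prof_k : 0 < k < 1 / 2;
  prof_L : 0 < L;
  prof_der : forall x, is_derive x 1 u (u1 x);
  prof_der1 : forall x, is_derive x 1 u1 ((u x ^+ 3 - u x) / eps ^+ 2);
  prof_energy : forall x, eps ^+ 2 * u1 x ^+ 2 =
    u x ^+ 4 / 2 - u x ^+ 2 + (2 * k - 2 * k ^+ 2);
  prof_0 : u 0 = 0;
  prof_shift : forall x, u (x + L) = - u x;
  prof_pos : forall x, 0 < x < L -> 0 < u x;
  prof_le : forall x, u x ^+ 2 <= 2 * k }.

Lemma prof_cont eps k L u u1 : profile eps k L u u1 -> continuous u.
Proof. by move=> p; exact: der_continuous (prof_der p). Qed.

Lemma der_shift f (df : R -> R) a : (forall x, is_derive x 1 f (df x)) ->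
  forall x, is_derive x 1 (fun y => f (y - a)) (df (x - a)).
Proof. by move=> fd x; der; rewrite addr0 mulr1. Qed.

Lemma prof_L0 eps k L u u1 : profile eps k L u u1 -> u L = 0.
Proof. by move=> p; rewrite -[L]add0r (prof_shift p) (prof_0 p) oppr0. Qed.

Lemma prof_ge0 eps k L u u1 x : profile eps k L u u1 -> 0 <= x <= L -> 0 <= u x.
Proof.
move=> p /andP[]; rewrite le_eqVlt => /predU1P[<-|x0].
  by rewrite (prof_0 p).
rewrite le_eqVlt => /predU1P[->|xL]; first by rewrite (prof_L0 p).
by rewrite ltW// (prof_pos p)// x0.
Qed.

Lemma Rint_le0_cont a b f : cont a b f -> (forall x, x \in `[a, b] -> 0 <= f x)
  ->
  \int[mu]_(x in `[a, b]) f x <= 0 -> forall x, a < x < b -> f x = 0.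
Proof.
move=> cf f0 If x /andP[ax xb].
have ab := lt_trans ax xb.
have fi := intg_cont cf.
have F0 y : y \in `[a, b] -> \int[mu]_(t in `[a, y]) f t = 0.
  rewrite in_itv/= => /andP[ay yb]; apply/eqP; rewrite eq_le.
  rewrite Rintegral_ge0 ?andbT; last first.
    move=> t; rewrite /= in_itv/= => /andP[at_ ty]; apply: f0.
    by rewrite in_itv/= at_ (le_trans ty).
  apply: le_trans If; rewrite (Rintegral_chasles ay yb fi) lerDl.
  apply: Rintegral_ge0 => t; rewrite /= in_itv/= => /andP[yt tb]; apply: f0.
  by rewrite in_itv/= tb (le_trans ay).
have [cin _ _] := (continuous_within_itvP f ab).1 cf.
have xab : x \in `]a, b[ by rewrite in_itv/= ax.
have [_ <-] := continuous_FTC1_closed xb fi ax (cin x xab).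
apply: der_derive1.
apply: (@near_eq_is_derive _ _ _ (fun=> 0)).
near=> y; apply/esym/F0/subset_itv_oo_cc.
by near: y; exact: near_in_itvoo.
Unshelve. all: by end_near. Qed.

Section with_profile.
Variables (eps k L : R) (u u1 : R -> R).
Hypothesis p : profile eps k L u u1.

Let e0 : eps != 0. Proof. by rewrite gt_eqF// (prof_eps p). Qed.

Let cpot a : continuous (fun x => (u (x - a) ^+ 2 - 1) / eps ^+ 2).
Proof.
apply: (@der_continuous R _ (fun x => 2 * u (x - a) * u1 (x - a) / eps ^+ 2))
  => x.
by have du := prof_der p; der => /=; field.
Qed.

(** The nonlinear equation is read as a linear one for [u] itself, so the positive solution fed to
    Picone's inequality is the profile and not a Jacobi field; hence the potential [u^2 - 1] instead
    of [3 u^2 - 1]. *)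
Lemma profile_picone a v g : is_wderiv a (a + L) v g -> v a = 0 ->
  v (a + L) = 0 ->
  0 <= \int[mu]_(x in `[a, a + L])
         (g x ^+ 2 + (u (x - a) ^+ 2 - 1) / eps ^+ 2 * v x ^+ 2).
Proof.
move=> vg va vb; have L0 := prof_L p.
apply: (@picone _ a (a + L) (fun x => u (x - a)) (fun x => u1 (x - a))
  (fun x => (u (x - a) ^+ 2 - 1) / eps ^+ 2)) vg va vb => //.
- by rewrite lerDl ltW.
- exact: der_shift (prof_der p).
- move=> x; apply: is_derive_eq (der_shift _ (prof_der1 p) x) _.
  by field.
- move=> x; rewrite in_itv/= => /andP[ax xb]; apply: (prof_ge0 p).
  by rewrite subr_ge0 ax lerBlDl.
- by move=> x /andP[ax xb]; apply: (prof_pos p); rewrite subr_gt0 ax ltrBlDl.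
Qed.

Lemma profile_wd a c d : is_wderiv c d (fun x => u (x - a)) (fun x => u1 (x -
  a)).
Proof.
apply: wd_C1; first exact: der_shift (prof_der p).
exact: (der_continuous (der_shift a (prof_der1 p))).
Qed.

Lemma profile_W12_0 a : W12_0 a (a + L) (fun x => u (x - a)).
Proof.
split; first by exists (fun x => u1 (x - a)); exact: profile_wd.
- by rewrite subrr (prof_0 p).
- by rewrite addrC addKr (prof_L0 p).
Qed.

(** The integrand is [(u u')']. This is the equality case of [profile_picone]. *)
Lemma profile_energy_identity a :
  \int[mu]_(x in `[a, a + L]) (u1 (x - a) ^+ 2 +
     (u (x - a) ^+ 2 - 1) / eps ^+ 2 * u (x - a) ^+ 2) = 0.
Proof.
have aL : a <= a + L by rewrite lerDl ltW// (prof_L p).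
have [du du1] := (prof_der p, prof_der1 p).
pose h x := u1 (x - a) ^+ 2 +
     (u (x - a) ^+ 2 - 1) / eps ^+ 2 * u (x - a) ^+ 2.
have dF x : is_derive x 1 (fun x => u (x - a) * u1 (x - a)) (h x).
  by rewrite /h; der => /=; field.
have ch : continuous h.
  apply: (@der_continuous R _ (fun x => 2 * u1 (x - a) *
    ((u (x - a) ^+ 3 - u (x - a)) / eps ^+ 2) +
    (4 * u (x - a) ^+ 3 - 2 * u (x - a)) / eps ^+ 2 * u1 (x - a))) => x.
  by rewrite /h; der => /=; field.
by rewrite (FTC aL dF ch) (addrC a) addrK subrr (prof_0 p) (prof_L0 p) !mul0r
  subrr.
Qed.

Let pot_intg a v : cont a (a + L) v -> intg a (a + L) (fun x => (u (x - a) ^+ 2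
  - 1) / eps ^+ 2 * v x ^+ 2).
Proof.
move=> cv; apply: intg_cont; apply: contM; last exact: contX.
exact: cont_continuous.
Qed.

Lemma energy_split a v g : is_wderiv a (a + L) v g ->
  energy eps a (a + L) v =
  eps / 2 * \int[mu]_(x in `[a, a + L])
         (g x ^+ 2 + (u (x - a) ^+ 2 - 1) / eps ^+ 2 * v x ^+ 2) +
  \int[mu]_(x in `[a, a + L])
     (eps^-1 * W (v x) - eps / 2 * ((u (x - a) ^+ 2 - 1) / eps ^+ 2 * v x ^+
       2)).
Proof.
move=> vg; have aL : a <= a + L by rewrite lerDl ltW// (prof_L p).
have cv := wd_cont aL vg.
rewrite (energyE _ aL vg) -RintZ; last first.
  by apply: intgD (pot_intg cv); case: (wd_sqint vg).
rewrite -RintD; last 2 first.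
- apply: intgZ; apply: intgD; last exact: pot_intg.
  by case: (wd_sqint vg).
- apply: intgB; first by apply: intgZ; apply: intg_cont; exact: cont_W.
  by apply: intgZ; exact: pot_intg.
by apply: eq_Rint => x _; ring.
Qed.

(** Once the Picone form is split off, what remains is pointwise: [W v - (u^2 - 1) v^2 / 2] exceeds
    its value at [v = u] by exactly [(v^2 - u^2)^2 / 4]. *)
Lemma energy_gap a v : W12_0 a (a + L) v ->
  energy eps a (a + L) (fun x => u (x - a)) +
  (4 * eps)^-1 * \int[mu]_(x in `[a, a + L]) (v x ^+ 2 - u (x - a) ^+ 2) ^+ 2
  <= energy eps a (a + L) v.
Proof.
move=> [[g vg] va vb]; have aL : a <= a + L by rewrite lerDl ltW// (prof_L p).
have cv := wd_cont aL vg.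
have ug := profile_wd a a (a + L).
have cu := wd_cont aL ug.
rewrite (energy_split vg) (energy_split ug) profile_energy_identity mulr0 add0r.
have hp := profile_picone vg va vb.
rewrite -RintZ; last first.
  apply: intg_cont; apply: contX; apply: contD; first exact: contX.
  by apply: contN; exact: contX.
rewrite -RintD; last 2 first.
- apply: intgB; first by apply: intgZ; apply: intg_cont; exact: cont_W.
  by apply: intgZ; exact: pot_intg.
- apply: intgZ; apply: intg_cont; apply: contX; apply: contD;
    first exact: contX.
  by apply: contN; exact: contX.
have e2 : 0 <= eps / 2 by rewrite divr_ge0// ltW// (prof_eps p).
apply: le_trans (lerD (mulr_ge0 e2 hp) (lexx _)).
rewrite add0r le_eqVlt; apply/orP; left; apply/eqP.
by apply: eq_Rint => x _; rewrite /W; field.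
Qed.

Lemma profile_minimizer a :
  minimizers eps a (a + L) (fun x => u (x - a)).
Proof.
split; first exact: profile_W12_0.
move=> v /energy_gap; apply: le_trans; rewrite lerDl mulr_ge0//.
  by rewrite invr_ge0 mulr_ge0// ltW// (prof_eps p).
by apply: Rintegral_ge0 => x _; exact: sqr_ge0.
Qed.

Lemma profile_min_energy a :
  min_energy eps a (a + L) = energy eps a (a + L) (fun x => u (x - a)).
Proof.
have [uW umin] := profile_minimizer a.
rewrite /min_energy; apply: xget_unique; first by exists (fun x => u (x - a)).
move=> _ [v [vW vmin] <-]; apply/eqP; by rewrite eq_le vmin// umin.
Qed.

Lemma positive_minimizer_exists : positive_minimizer eps L u.
Proof.
have := profile_minimizer 0; rewrite add0r.
rewrite (_ : (fun x => u (x - 0)) = u); last by apply/funext=> x; rewrite subr0.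
by move=> m; split => // x; rewrite in_itv/=; exact: (prof_pos p).
Qed.

(** Equal energies annihilate the gap, so [v^2 = u^2], and positivity picks the sign. Values outside
    [[0, L]] are arbitrary, but [u2p] never reads them. *)
Lemma positive_minimizer_unique v : positive_minimizer eps L v ->
  forall x, x \in `[0, L] -> v x = u x.
Proof.
move=> [[vW vmin] vpos].
have [[g vg] v0 vL] := vW; have L0 := ltW (prof_L p).
have cv := wd_cont L0 vg.
have := @energy_gap 0 v; rewrite add0r => /(_ vW).
have := vmin _ (positive_minimizer_exists).1.1.
rewrite (_ : (fun x => u (x - 0)) = u); last by apply/funext=> x; rewrite subr0.
move=> h1 h2.
have i4 : 0 < (4 * eps)^-1 by rewrite invr_gt0 mulr_gt0// (prof_eps p).
have cf : cont 0 L (fun x => (v x ^+ 2 - u (x - 0) ^+ 2) ^+ 2).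
  apply: contX; apply: contD; first exact: contX.
  apply: contN; apply: contX; apply: cont_continuous.
  exact: (der_continuous (der_shift 0 (prof_der p))).
have := Rint_le0_cont cf (fun x _ => sqr_ge0 _).
have -> : \int[mu]_(x in `[0, L]) (v x ^+ 2 - u (x - 0) ^+ 2) ^+ 2 <= 0.
  by rewrite -(pmulr_rle0 _ i4); move: (le_trans h2 h1); rewrite gerDl.
move=> /(_ isT) vu x; rewrite in_itv/= le_eqVlt => /andP[/predU1P[<- _|x0]].
  by rewrite v0 (prof_0 p).
rewrite le_eqVlt => /predU1P[->|xL]; first by rewrite vL (prof_L0 p).
have x0L : 0 < x < L by rewrite x0.
have := vu x x0L; rewrite subr0 => /eqP; rewrite sqrf_eq0 subr_eq0 eqf_sqr.
move=> /orP[/eqP//|/eqP vE].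
have := vpos x; rewrite in_itv/= => /(_ x0L); rewrite vE oppr_gt0.
by move=> /(lt_trans (prof_pos p x0L)); rewrite ltxx.
Qed.

End with_profile.
End profiles.

(** * Construction of the profiles *)

Section elliptic_period.
Context {R : realType}.
Implicit Types (f g h F : R -> R) (x y a b c d L eps k t : R).

(** The period and the least energy are both differentiated through such explicit estimates, rather
    than under the integral sign or along a family of minimizers. *)
Lemma is_derive_quadratic_error f x l C d : 0 < d ->
  (forall y, `|y - x| < d ->
     `|f y - f x - (y - x) * l| <= C * (y - x) ^+ 2) ->
  is_derive x 1 f l.
Proof.
move=> d0 hf; apply/is_derive1_caratheodory.
exists (fun z => if z == x then l else (f z - f x) / (z - x)); split.
- move=> z; case: eqP => [->|/eqP zx]; first by rewrite !subrr mulr0.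
  by rewrite divfK// subr_eq0.
- apply/cvgrPdist_le => e e0; rewrite eqxx.
  near=> z; case: eqP => [_|/eqP zx]; first by rewrite subrr normr0 ltW.
  have zx0 : 0 < `|z - x| by rewrite normr_gt0 subr_eq0.
  have zd : `|z - x| < d.
    by rewrite distrC; near: z; exists d.
  have ze : (`|C| + 1) * `|z - x| < e.
    have C0 : 0 < `|C| + 1 by rewrite ltr_wpDl.
    rewrite mulrC -ltr_pdivlMr// distrC; near: z.
    by exists (e / (`|C| + 1)) => //=; rewrite divr_gt0.
  have zx' : z - x != 0 by rewrite subr_eq0.
  rewrite (_ : l - _ = - ((f z - f x - (z - x) * l) / (z - x))); last by field.
  rewrite normrN normrM normfV ler_pdivrMr//.
  apply: (le_trans (hf z zd)); rewrite -real_normK ?num_real// expr2 mulrA.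
  rewrite ler_pM2r//; apply: le_trans (ltW ze); rewrite ler_pM2r//.
  by rewrite (le_trans (ler_norm C))// lerDl.
by rewrite eqxx.
Unshelve. all: by end_near. Qed.

Definition primitive f : R -> R :=
  xget (cst 0) [set F | F 0 = 0 /\ forall x, is_derive x 1 F (f x)].

Lemma primitiveP f : continuous f ->
  primitive f 0 = 0 /\ forall x, is_derive x 1 (primitive f) (f x).
Proof.
move=> cf; apply: (@xgetPex _ (cst 0)
  [set F | F 0 = 0 /\ forall x, is_derive x 1 F (f x)]).
by have [F] := primitive_exists cf; exists F.
Qed.

(* The profile is [Num.sqrt (2 * k) * sin (angle k (x / eps))], and [speed k t]
   is the derivative of [angle k] where it takes the value [t]. *)
Definition speed k t : R := Num.sqrt (1 - k * (1 + sin t ^+ 2)).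
Definition time k : R -> R := primitive (fun t => (speed k t)^-1).
(** This is [T(k)]: half a period of the profile, in the variable [x / eps]. *)
Definition period k : R := time k pi.

Lemma sin2_le1 t : sin t ^+ 2 <= 1 :> R.
Proof. by rewrite -[leRHS](cos2Dsin2 t) lerDr sqr_ge0. Qed.

Lemma speed_sq k t : 0 < k < 1 / 2 ->
  speed k t ^+ 2 = 1 - k * (1 + sin t ^+ 2).
Proof.
move=> k12; rewrite sqr_sqrtr//.
by have := sin2_le1 t; have := sqr_ge0 (sin t); nra.
Qed.

Lemma speed_ge k t : 0 < k < 1 / 2 -> Num.sqrt (1 - 2 * k) <= speed k t.
Proof.
by move=> k12; rewrite ler_wsqrtr//; have := sin2_le1 t; nra.
Qed.

Lemma speed_gt0 k t : 0 < k < 1 / 2 -> 0 < speed k t.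
Proof.
by move=> k12; apply: lt_le_trans (speed_ge t k12); rewrite sqrtr_gt0; lra.
Qed.

Lemma speed_le1 k t : 0 < k < 1 / 2 -> speed k t <= 1.
Proof.
move=> k12; rewrite -[leRHS]sqrtr1 ler_wsqrtr//.
by have := sqr_ge0 (sin t); nra.
Qed.

Lemma der_speed k t : 0 < k < 1 / 2 ->
  is_derive t 1 (speed k) (- (k * sin t * cos t / speed k t)).
Proof.
move=> k12; have sp := speed_gt0 t k12.
have s0 : 0 < 1 - k * (1 + sin t ^+ 2) by rewrite -sqrtr_gt0.
have ds := @is_derive_sin R.
pose v y := 1 - k * (1 + sin y ^+ 2).
have dv : is_derive t 1 v (- k * (2 * sin t * cos t)).
  by rewrite /v; der => /=; ring.
have := @der_comp R Num.sqrt v t _ _ (is_derive1_sqrt s0) dv.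
rewrite -/(speed k t) => h; apply: is_derive_eq h _.
by field; rewrite gt_eqF.
Qed.

Lemma continuous_speed_inv k : 0 < k < 1 / 2 ->
  continuous (fun t => (speed k t)^-1).
Proof.
move=> k12; have ds t := der_speed t k12.
apply: (@der_continuous R _ (fun t =>
  - (- (k * sin t * cos t / speed k t) / speed k t ^+ 2))) => t.
by der => //; rewrite gt_eqF// speed_gt0.
Qed.

Section fixed_k.
Variable k : R.
Hypothesis k12 : 0 < k < 1 / 2.

Lemma time0 : time k 0 = 0.
Proof. by case: (primitiveP (continuous_speed_inv k12)). Qed.

Lemma der_time t : is_derive t 1 (time k) (speed k t)^-1.
Proof. by case: (primitiveP (continuous_speed_inv k12)). Qed.

Lemma time_lt t t' : t < t' -> time k t < time k t'.
Proof.
move=> tt'; apply: (der_increasing tt' der_time) => s _.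
by rewrite invr_gt0 speed_gt0.
Qed.

(** Because [speed] is at most 1. It makes [time k] unbounded in both directions, hence onto. *)
Lemma time_incr t t' : t <= t' -> t' - t <= time k t' - time k t.
Proof.
move=> tt'; have dt := der_time.
have : time k t - t <= time k t' - t'.
  have dd (s : R) : is_derive s 1 (fun s => time k s - s) ((speed k s)^-1 - 1)
    by der.
  apply: (der_nondecreasing tt' dd) => s _;
    rewrite subr_ge0 -[leLHS]invr1 lef_pV2 ?posrE ?speed_gt0//.
  exact: speed_le1.
by lra.
Qed.

Lemma time_inj : injective (time k).
Proof.
move=> t t' e; case: (ltgtP t t') => // h; have := time_lt h.
- by rewrite e ltxx.
- by rewrite e ltxx.
Qed.

Lemma time_surj x : exists t, time k t = x.
Proof.
have [|||t _ tx] := @IVT R (time k) (- `|x|) `|x| x.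
- by rewrite ge0_cp.
- exact/continuous_subspaceT/(der_continuous der_time).
- have h1 : 0 <= `|x| by [].
  have h2 : - `|x| <= 0 by rewrite oppr_le0.
  have := time_incr h1; have := time_incr h2; rewrite time0 => a1 a2.
  have [l r] : - `|x| <= x /\ x <= `|x|.
    by rewrite ler_norm -[x in _ <= x]opprK lerN2 -normrN ler_norm.
  rewrite ge_min le_max; apply/andP; split; apply/orP; [left|right]; lra.
by exists t.
Qed.

Lemma time_shift t : time k (t + pi) = time k t + period k.
Proof.
have dt := der_time.
have h x : is_derive x 1 (fun s => time k (s + pi) - time k s) 0.
  by der; rewrite addr0 mulr1 /speed sinDpi sqrrN subrr.
have := @is_derive_0_is_cst R _ t 0 h;
  rewrite /= add0r time0 subr0 /period => <-.
by ring.
Qed.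

Definition angle x : R := xget 0 [set t | time k t = x].

Lemma angleK x : time k (angle x) = x.
Proof.
by apply: (@xgetPex _ 0 [set t | time k t = x]); exact: time_surj.
Qed.

Lemma timeK t : angle (time k t) = t.
Proof. exact/time_inj/angleK. Qed.

Lemma der_angle x : is_derive x 1 angle (speed k (angle x)).
Proof.
rewrite -{1}[x]angleK -[speed _ _]invrK.
apply: (@is_derive_inverse R (time k)).
- by near=> y; exact: timeK.
- by near=> y; exact: (der_continuous der_time).
- exact: der_time.
- by rewrite invr_eq0 gt_eqF// speed_gt0.
Unshelve. all: by end_near. Qed.

Lemma period_gt0 : 0 < period k.
Proof. by rewrite -time0; exact/time_lt/pi_gt0. Qed.

Lemma profile_exists eps : 0 < eps ->
  exists u u1, profile eps k (eps * period k) u u1.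
Proof.
move=> e0; have /andP[k0 k1] := k12; have e0' : eps != 0 by rewrite gt_eqF.
pose m := Num.sqrt (2 * k).
have m2 : m ^+ 2 = 2 * k by rewrite sqr_sqrtr; lra.
have da := der_angle; have dsin := @is_derive_sin R;
  have dcos := @is_derive_cos R.
pose th x := angle (x / eps).
have dth x : is_derive x 1 th (speed k (th x) / eps).
  by rewrite /th; der; rewrite mul1r mulr0 addr0.
have dsp x : is_derive x 1 (fun y => speed k (th y))
    (- (k * sin (th x) * cos (th x) / eps)).
  apply: is_derive_eq (der_comp (der_speed (th x) k12) (dth x)) _.
  by field; rewrite e0' gt_eqF// speed_gt0.
have th_shift x : th (x + eps * period k) = th x + pi.
  apply: time_inj; rewrite time_shift !angleK.
  by field.
have th_mono x y : x < y -> th x < th y.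
  move=> xy; rewrite ltNge; apply/negP => h.
  have : time k (th y) <= time k (th x).
    move: h; rewrite le_eqVlt => /predU1P[->//|h]; exact/ltW/time_lt.
  by rewrite !angleK ler_pM2r ?invr_gt0// leNgt xy.
have th0 : th 0 = 0 by apply: time_inj; rewrite angleK mul0r time0.
exists (fun x => m * sin (th x)), (fun x => m * cos (th x) * speed k (th x) /
  eps).
split => //.
- by rewrite mulr_gt0// period_gt0.
- by move=> x; der => /=; field.
- move=> x; der => /=.
  (* The square root [m] is known only through [m ^+ 2 = 2 * k], so its even powers are factored
     out. *)
  rewrite (_ : (m * sin (th x)) ^+ 3 = m ^+ 2 * (m * sin (th x) ^+ 3));
    last by ring.
  have h1 := speed_sq (th x) k12; rewrite m2.
  have h2 := cos2Dsin2 (th x).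
  rewrite (_ : _ + _ = (m * (- sin (th x)) * speed k (th x) ^+ 2 - m * k * sin
    (th x) * cos (th x) ^+ 2) / eps ^+ 2); last by field.
  by rewrite h1 (_ : cos (th x) ^+ 2 = 1 - sin (th x) ^+ 2); [field|lra].
- move=> x; rewrite (_ : eps ^+ 2 * _ =
    m ^+ 2 * cos (th x) ^+ 2 * speed k (th x) ^+ 2); last by field.
  rewrite speed_sq// cos2sin2 (_ : (m * sin (th x)) ^+ 4 =
    m ^+ 2 * m ^+ 2 * sin (th x) ^+ 4); last by ring.
  by rewrite [(m * sin (th x)) ^+ 2]exprMn m2; field.
- by rewrite th0 sin0 mulr0.
- by move=> x; rewrite th_shift sinDpi mulrN.
- move=> x /andP[x0 xL]; rewrite mulr_gt0//.
    by rewrite sqrtr_gt0; lra.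
  apply: sin_gt0_pi; rewrite -{1}th0 th_mono//=.
  by have := th_mono _ _ xL;
    rewrite -[X in _ < th X -> _]add0r th_shift th0 add0r.
- move=> x; rewrite exprMn m2 -[leRHS]mulr1 ler_wpM2l ?sin2_le1//.
  by lra.
Qed.

End fixed_k.
End elliptic_period.

(** * Dependence of the period on the modulus *)

Section period_function.
Context {R : realType}.
Implicit Types (f g h F : R -> R) (x y a b c d L eps k t s : R).

Lemma derivable_continuous_fun f :
  (forall x, exists l, is_derive x 1 f l) -> continuous f.
Proof.
move=> fd x; have [l [dl _]] := fd x.
exact/differentiable_continuous/derivable1_diffP.
Qed.

(** For the speeds [s] and [s'], [(s - s') (s + s') = (k' - k) (1 + sin^2 t)] and [s + s' <= 2] give
    the factor [1 / 2]; dividing by [s s' <= 1] only helps. *)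
Lemma speed_inv_expansive k k' t : 0 < k -> k <= k' -> k' < 1 / 2 ->
  (k' - k) / 2 <= (speed k' t)^-1 - (speed k t)^-1.
Proof.
move=> k0 kk' k'1.
have [h h'] : 0 < k < 1 / 2 /\ 0 < k' < 1 / 2 by lra.
have := speed_sq t h; have := speed_sq t h'.
have := speed_gt0 t h; have := speed_gt0 t h'.
have := speed_le1 t h; have := speed_le1 t h'.
have := sqr_ge0 (sin t).
set s := speed k t; set s' := speed k' t; set q := sin t ^+ 2.
move=> q0 s'1 s1 s'0 s0 s'2 s2.
have hd : (k' - k) / 2 <= s - s'.
  have e : (s - s') * (s + s') = (k' - k) * (1 + q).
    by rewrite -subr_sqr s2 s'2; ring.
  have ss' : 0 <= s - s'.
    rewrite -(@pmulr_lge0 _ (s + s')) ?addr_gt0// e; nra.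
  nra.
apply: (le_trans hd).
have -> : s'^-1 - s^-1 = (s - s') / (s * s') by field; rewrite !gt_eqF.
rewrite ler_pdivlMr ?mulr_gt0//; apply: ler_piMr; first by lra.
by apply: mulr_ile1 => //; exact: ltW.
Qed.

Lemma period_expansive k k' : 0 < k -> k <= k' -> k' < 1 / 2 ->
  (k' - k) / 2 * pi <= period k' - period k.
Proof.
move=> k0 kk' k'1.
have [h h'] : 0 < k < 1 / 2 /\ 0 < k' < 1 / 2 by lra.
have dt := der_time h; have dt' := der_time h'.
have dG t : is_derive t 1 (fun t => time k' t - time k t - (k' - k) / 2 * t)
    ((speed k' t)^-1 - (speed k t)^-1 - (k' - k) / 2).
  by der; ring.
have := der_nondecreasing (pi_ge0 R) dG.
rewrite !time0// /period => hh;
  suff : 0 - 0 - (k' - k) / 2 * 0 <= time k' pi - time k pi - (k' - k) / 2 * pi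
    by lra.
by apply: hh => t _; rewrite subr_ge0 speed_inv_expansive.
Qed.

Lemma period_inj k k' : 0 < k < 1 / 2 -> 0 < k' < 1 / 2 ->
  period k = period k' -> k = k'.
Proof.
wlog kk' : k k' / k <= k' => [hw h h' e|].
  by case: (leP k k') => [|/ltW] kk'; [exact: hw|apply/esym/hw].
move=> /andP[k0 _] /andP[_ k'1] e; apply/eqP; rewrite eq_le kk' /=.
have := period_expansive k0 kk' k'1; rewrite e subrr.
by rewrite pmulr_lle0 ?pi_gt0//; lra.
Qed.

Definition speed_inv_dk k t : R := (1 + sin t ^+ 2) / (2 * speed k t ^+ 3).
Definition period_dk k : R := primitive (speed_inv_dk k) pi.

Lemma continuous_speed_inv_dk k : 0 < k < 1 / 2 -> continuous (speed_inv_dk k).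
Proof.
move=> h; apply: derivable_continuous_fun => t.
have ds t := der_speed t h; have dsin := @is_derive_sin R.
have s0 : speed k t != 0 by rewrite gt_eqF// speed_gt0.
eexists; rewrite /speed_inv_dk; repeat der1.
by rewrite mulf_neq0// expf_neq0.
Qed.

Lemma period_dk_gt0 k : 0 < k < 1 / 2 -> 0 < period_dk k.
Proof.
move=> h; have [P0 dP] := primitiveP (continuous_speed_inv_dk h).
rewrite /period_dk -[ltLHS]P0; apply: der_increasing (pi_gt0 R) dP _ => t _.
rewrite divr_gt0//; first by rewrite ltr_wpDr ?sqr_ge0.
by rewrite mulr_gt0// exprn_gt0// speed_gt0.
Qed.

(** The Taylor remainder factors exactly into three nonnegative terms, at most [4 (k' - k)^2], [2]
    and [1 / (4 S^5)] with [S = sqrt (1 - 2 k1)]; this gives both its sign and the constant. *)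
Lemma speed_inv_expansion k k' k1 t : 0 < k < 1 / 2 -> 0 < k' < 1 / 2 ->
  k <= k1 -> k' <= k1 -> k1 < 1 / 2 ->
  0 <= (speed k' t)^-1 - (speed k t)^-1 - (k' - k) * speed_inv_dk k t <=
    2 / Num.sqrt (1 - 2 * k1) ^+ 5 * (k' - k) ^+ 2.
Proof.
move=> h h' kk1 k'k1 k1h.
have := speed_sq t h; have := speed_sq t h'.
have : Num.sqrt (1 - 2 * k1) <= speed k t.
  by apply: le_trans (speed_ge t h); rewrite ler_wsqrtr//; lra.
have : Num.sqrt (1 - 2 * k1) <= speed k' t.
  by apply: le_trans (speed_ge t h'); rewrite ler_wsqrtr//; lra.
have : 0 < Num.sqrt (1 - 2 * k1) by rewrite sqrtr_gt0; lra.
rewrite /speed_inv_dk; have := sqr_ge0 (sin t); have := sin2_le1 t.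
set s := speed k t; set s' := speed k' t; set S := Num.sqrt _.
set q := sin t ^+ 2 => q1 q0 S0 Ss' Ss s'2 s2.
have s0 : 0 < s := lt_le_trans S0 Ss.
have s'0 : 0 < s' := lt_le_trans S0 Ss'.
have q2 : (k' - k) * (1 + q) = (s - s') * (s + s').
  by rewrite -subr_sqr s2 s'2; ring.
have s0' : s != 0 by rewrite gt_eqF.
have s'0' : s' != 0 by rewrite gt_eqF.
have ss0 : s + s' != 0 by rewrite gt_eqF// addr_gt0.
rewrite (_ : _ - _ - _ =
  (((k' - k) * (1 + q)) ^+ 2 * ((2 * s + s') / (s + s'))) *
  (2 * s ^+ 3 * s' * (s + s'))^-1); last first.
  rewrite [(k' - k) * (_ / _)]mulrA q2; field.
  by rewrite s0' s'0' ss0.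
have A1 : 0 <= ((k' - k) * (1 + q)) ^+ 2 <= (k' - k) ^+ 2 * 4.
  rewrite sqr_ge0 exprMn ler_wpM2l ?sqr_ge0//; nra.
have A2 : 0 <= (2 * s + s') / (s + s') <= 2.
  rewrite ler_pdivrMr ?addr_gt0// divr_ge0 ?addr_ge0 ?mulr_ge0 ?ltW//=; lra.
have A3 : 0 <= (2 * s ^+ 3 * s' * (s + s'))^-1 <= (4 * S ^+ 5)^-1.
  have S5 : 0 < S ^+ 5 by rewrite exprn_gt0.
  have dd : 0 < 2 * s ^+ 3 * s' * (s + s').
    by rewrite !mulr_gt0// ?exprn_gt0// addr_gt0.
  rewrite invr_ge0 ltW//= lef_pV2 ?posrE//; last by rewrite mulr_gt0.
  rewrite (_ : 4 * S ^+ 5 = 2 * S ^+ 3 * S * (S + S)); last by ring.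
  have S3 : 0 <= S ^+ 3 by rewrite exprn_ge0 ?ltW.
  apply: ler_pM; [by rewrite !mulr_ge0// ltW|by rewrite addr_ge0 ?ltW| |exact:
    lerD].
  apply: ler_pM; [by rewrite !mulr_ge0// ltW|by rewrite ltW| |by []].
  by rewrite ler_pM2l//; apply: lerXn2r => //; rewrite nnegrE ltW.
case/andP: A1 A2 A3 => a1 b1 /andP[a2 b2] /andP[a3 b3].
apply/andP; split; first exact: (mulr_ge0 (mulr_ge0 a1 a2) a3).
apply: le_trans (ler_pM (mulr_ge0 a1 a2) a3 (ler_pM a1 a2 b1 b2) b3) _.
by rewrite le_eqVlt; apply/orP; left; apply/eqP; field; rewrite gt_eqF.
Qed.

Lemma der_period k : 0 < k < 1 / 2 -> is_derive k 1 period (period_dk k).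
Proof.
move=> h; have /andP[k0 k1] := h.
(* [K] lies midway between [k] and [1 / 2], so one constant serves every [k'] within [d] of [k]. *)
pose K := (k + 1 / 2) / 2.
pose d := Num.min k (K - k).
have d0 : 0 < d by rewrite lt_min k0 /K; lra.
apply: (@is_derive_quadratic_error _ _ _ _ (2 / Num.sqrt (1 - 2 * K) ^+ 5 * pi)
  d d0).
move=> k' kd.
have [k'0 k'K] : 0 < k' /\ k' < K.
  move: kd; rewrite lt_min !ltr_norml => /andP[/andP[a _] /andP[_ b]]; lra.
have h' : 0 < k' < 1 / 2 by rewrite /K in k'K; lra.
have hK : k <= K /\ k' <= K /\ K < 1 / 2 by rewrite /K in k'K *; lra.
case: hK => kK [k'K' K1].
have b t := speed_inv_expansion t h h' kK k'K' K1.
move: b; set C := _ / _ => b.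
have [P0 dP] := primitiveP (continuous_speed_inv_dk h).
have dt := der_time h; have dt' := der_time h'.
(* [G pi] is the remainder for the period. Integrating the pointwise bounds amounts to the
   monotonicity of [G] and of [C (k' - k)^2 t - G t]. *)
pose G t := time k' t - time k t - (k' - k) * primitive (speed_inv_dk k) t.
pose G1 t := (speed k' t)^-1 - (speed k t)^-1 - (k' - k) * speed_inv_dk k t.
have dG t : is_derive t 1 G (G1 t) by rewrite /G /G1; der; ring.
have dH t : is_derive t 1 (fun t => C * (k' - k) ^+ 2 * t - G t) (C * (k' - k)
  ^+ 2 - G1 t).
  by der; ring.
have G0 : G 0 = 0 by rewrite /G !time0// P0; ring.
have l1 : G 0 <= G pi.
  by apply: der_nondecreasing (pi_ge0 R) dG _ => t _; case/andP: (b t).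
have l2 := der_nondecreasing (pi_ge0 R) dH.
have {}l2 : C * (k' - k) ^+ 2 * 0 - G 0 <= C * (k' - k) ^+ 2 * pi - G pi.
  by apply: l2 => t _; rewrite subr_ge0; case/andP: (b t).
rewrite (_ : _ - _ - _ = G pi)//.
by rewrite ger0_norm; lra.
Qed.

Lemma period_small t : pi < t -> exists2 k, 0 < k < 1 / 2 & period k <= t.
Proof.
move=> pt; have t0 : 0 < t := lt_trans (pi_gt0 R) pt.
have pi0 := pi_gt0 R.
(* With [1 - 2 k = r^2] the speed is at least [r], so the period is at most [pi / r = t]. *)
pose r := pi / t.
have r1 : 0 < r < 1 by rewrite divr_gt0//= ltr_pdivrMr// mul1r.
have hk : 0 < (1 - r ^+ 2) / 2 < 1 / 2 by nra.
exists ((1 - r ^+ 2) / 2) => //; set k := (1 - r ^+ 2) / 2 in hk *.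
have dt := der_time hk.
have dH s : is_derive s 1 (fun s => r^-1 * s - time k s) (r^-1 - (speed k
  s)^-1).
  by der; ring.
have := der_nondecreasing (pi_ge0 R) dH.
rewrite time0// /period => hh.
suff : r^-1 * 0 - 0 <= r^-1 * pi - time k pi.
  have -> : r^-1 * pi = t by rewrite /r invf_div divfK// gt_eqF.
  lra.
apply: hh => s _; rewrite subr_ge0 lef_pV2 ?posrE ?speed_gt0//;
  last by case/andP: r1.
apply: le_trans (speed_ge s hk).
rewrite (_ : 1 - 2 * k = r ^+ 2); last by rewrite /k; field.
by rewrite sqrtr_sqr ler_norm.
Qed.

(** With [1 - 2 k = r^2] the speed is at most [sqrt (r^2 + cos^2)], so its inverse dominates
    [sin cos / (r^2 + cos^2)]. The primitive [- ln (r^2 + cos^2) / 2] of this minorant gains at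
    least [- ln r] on [[0, pi / 2]], whence the choice [r = exp (- t)]. *)
Lemma period_large t : 0 < t -> exists2 k, 0 < k < 1 / 2 & t <= period k.
Proof.
move=> t0.
pose r := expR (- t).
have r0 : 0 < r by exact: expR_gt0.
have r1 : r < 1 by rewrite -expR0 ltr_expR oppr_lt0.
have hk : 0 < (1 - r ^+ 2) / 2 < 1 / 2 by nra.
exists ((1 - r ^+ 2) / 2) => //; set k := (1 - r ^+ 2) / 2 in hk *.
have dk : 1 - 2 * k = r ^+ 2 by rewrite /k; field.
have /andP[k0 k1] := hk.
have dt := der_time hk; have dsin := @is_derive_sin R.
have dcos := @is_derive_cos R.
have A0 s : 0 < r ^+ 2 + cos s ^+ 2 by rewrite ltr_wpDr ?sqr_ge0// exprn_gt0.
have dln s : is_derive s 1 (fun s => ln (r ^+ 2 + cos s ^+ 2))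
    ((r ^+ 2 + cos s ^+ 2)^-1 * (- (2 * cos s * sin s))).
  apply: (@der_comp R (@ln R)); first exact: is_derive1_ln.
  by der => /=; ring.
have dH s : is_derive s 1 (fun s => time k s + ln (r ^+ 2 + cos s ^+ 2) / 2)
    ((speed k s)^-1 - sin s * cos s / (r ^+ 2 + cos s ^+ 2)).
  by der => /=; field; rewrite !gt_eqF// speed_gt0.
have pi2 : 0 <= pi / 2 :> R by rewrite divr_ge0// pi_ge0.
have := der_nondecreasing pi2 dH.
rewrite time0// cos0 cos_pihalf => hh.
have {hh} h1 : 0 + ln (r ^+ 2 + 1 ^+ 2) / 2 <= time k (pi / 2) + ln (r ^+ 2 + 0
  ^+ 2) / 2.
  apply: hh => s _; rewrite subr_ge0.
  have sp0 := speed_gt0 s hk; have sp2 := speed_sq s hk.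
  rewrite ler_pdivrMr// [leRHS]mulrC ler_pdivlMr//.
  have c1 := sqr_ge0 (cos s); have s1 := sin2_le1 s.
  have h2 : speed k s ^+ 2 <= r ^+ 2 + cos s ^+ 2.
    rewrite sp2 -dk sin2cos2; nra.
  set A := r ^+ 2 + _ in h2 *; have A1 : 0 < A := A0 s.
  have h3 : (sin s * cos s) ^+ 2 <= A.
    rewrite exprMn (@le_trans _ _ (cos s ^+ 2))//.
      by rewrite ler_piMl.
    by rewrite /A lerDr sqr_ge0.
  have h4 : (sin s * cos s * speed k s) ^+ 2 <= A ^+ 2.
    by rewrite exprMn [A ^+ 2]expr2 ler_pM// sqr_ge0.
  move: h4; set X := sin s * cos s * speed k s => h4.
  by have [//|AX] := leP X A; nra.
have h2 : 0 <= ln (r ^+ 2 + 1 ^+ 2).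
  by rewrite ln_ge0// expr1n lerDr sqr_ge0.
have h3 : ln (r ^+ 2 + 0 ^+ 2) = - (2 * t).
  by rewrite expr0n addr0 lnXn// /r expRK [- t *+ 2]mulr2n; lra.
have h4 : time k (pi / 2) <= period k.
  by apply/ltW/time_lt => //; have := pi_gt0 R; lra.
apply: le_trans h4; move: h1 h2; rewrite h3.
set l := ln _; set T := time k (pi / 2) => *; lra.
Qed.

Lemma continuous_period a b : 0 < a -> b < 1 / 2 -> cont a b period.
Proof.
move=> a0 b1; apply/subspace_continuousP => k /=.
rewrite in_itv/= => /andP[ak kb].
have hk : 0 < k < 1 / 2 by lra.
have ck : {for k, continuous period}.
  apply/differentiable_continuous/derivable1_diffP.
  by case: (der_period hk).
exact: cvg_within_filter ck.
Qed.

Lemma period_surj t : pi < t -> exists2 k, 0 < k < 1 / 2 & period k = t.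
Proof.
move=> pt; have t0 : 0 < t := lt_trans (pi_gt0 R) pt.
have [a ha Ta] := period_small pt; have [b hb Tb] := period_large t0.
have /andP[a0 a1] := ha; have /andP[b0 b1] := hb.
have [ab|/ltW ba] := leP a b.
  have [|k kab <-] := IVT ab (continuous_period a0 b1) (v := t).
    by rewrite ge_min le_max Ta Tb orbT.
  by exists k => //; move: kab; rewrite in_itv/=; lra.
(* If [b <= a], monotonicity gives [period b <= period a <= t <= period b], so [a] itself works. *)
exists a => //; apply/eqP; rewrite eq_le Ta (le_trans Tb)//.
have := period_expansive b0 ba a1.
move=> h; rewrite -subr_ge0; apply: le_trans h.
by rewrite mulr_ge0 ?pi_ge0//; lra.
Qed.

(* Junk value [0] when no profile has half-period [l]: [l <= pi * eps]. *)
Definition modulus eps l : R :=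
  xget 0 [set k | 0 < k < 1 / 2 /\ eps * period k = l].

Lemma modulusP eps l : 0 < eps -> pi * eps < l ->
  0 < modulus eps l < 1 / 2 /\ eps * period (modulus eps l) = l.
Proof.
move=> e0 el.
apply: (@xgetPex _ 0 [set k | 0 < k < 1 / 2 /\ eps * period k = l]).
have [|k hk e] := @period_surj (l / eps); first by rewrite ltr_pdivlMr.
by exists k; split => //; rewrite e; field; rewrite gt_eqF.
Qed.

(** Derivative of an inverse function: injectivity of [period] makes the choice in [modulus] a
    genuine left inverse of [eps * period] near [k]. *)
Lemma der_modulus eps l : 0 < eps -> pi * eps < l ->
  exists2 c, 0 < c & is_derive l 1 (modulus eps) c.
Proof.
move=> e0 el; have [hk e] := modulusP e0 el.
set k := modulus eps l in hk e.
have cancel_near : {near k, cancel (fun k => eps * period k) (modulus eps)}.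
  near=> x.
  have hx : 0 < x < 1 / 2 by near: x; apply: near_in_itvoo; rewrite in_itv.
  apply: xget_unique => // y [hy /(mulfI (negbT (gt_eqF e0)))].
  exact: period_inj.
have cont_near : {near k, continuous (fun k => eps * period k)}.
  near=> x.
  have hx : 0 < x < 1 / 2 by near: x; apply: near_in_itvoo; rewrite in_itv.
  apply: continuousM; first exact: cst_continuous.
  apply/differentiable_continuous/derivable1_diffP.
  by case: (der_period hx).
have dk := der_period hk; have T0 := period_dk_gt0 hk.
have dT : is_derive k 1 (fun k => eps * period k) (eps * period_dk k).
  by notypeclasses refine (is_derive_eq (derM (derC _ _) dk) _); ring.
exists (eps * period_dk k)^-1; first by rewrite invr_gt0 mulr_gt0.
rewrite -{1}e; apply: (is_derive_inverse cancel_near cont_near dT).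
by rewrite gt_eqF// mulr_gt0.
Unshelve. all: by end_near. Qed.

End period_function.

(** * Jacobi fields *)

Section alternating_functions.
Context {R : realType}.
Implicit Types (f : R -> R) (x L : R).

Lemma alternating_int f L : (forall x, f (x + L) = - f x) ->
  forall (i : int) x, f (x + i%:~R * L) = (-1) ^ i * f x.
Proof.
move=> fL.
have nat_case (n : nat) x : f (x + n%:R * L) = (-1) ^+ n * f x.
  elim: n x => [|n ih] x; first by rewrite mul0r addr0 mul1r.
  by rewrite mulrSr mulrDl mul1r addrA fL ih exprS; ring.
case=> [n|n] x; first exact: nat_case.
rewrite NegzE mulrNz mulNr.
have := nat_case n.+1 (x - n.+1%:R * L).
rewrite subrK => ->; rewrite mulrA -exprnN -exprVn invrN1.
by rewrite -exprD addnn -mul2n exprM sqrrN !expr1n mul1r.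
Qed.

Lemma alternating_der f (df : R -> R) L : (forall x, f (x + L) = - f x) ->
  (forall x, is_derive x 1 f (df x)) -> forall x, df (x + L) = - df x.
Proof.
move=> fL fd x.
have h1 : is_derive x 1 (fun y => f (y + L)) (df (x + L)).
  by der; rewrite addr0 mulr1.
have h2 : is_derive x 1 (fun y => f (y + L)) (- df x).
  exact: (der_eqfun (derN (fd x)) (fun y => esym (fL y))).
exact: der_unique h1 h2.
Qed.

Lemma twice_derP f (f1 f2 : R -> R) : (forall x, is_derive x 1 f (f1 x)) ->
  (forall x, is_derive x 1 f1 (f2 x)) ->
  forall x, twice_derivable f x /\ derive1n 2 f x = f2 x.
Proof.
move=> fd f1d x; have e : derive1 f = f1.
  by apply/funext => y; exact: der_derive1.
split; last by rewrite derive1nS derive1n1 e; exact: der_derive1.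
split; first by near=> y; case: (fd y).
by rewrite e; case: (f1d x).
Unshelve. all: by end_near. Qed.

Lemma twice_derivable_der f : (forall x, twice_derivable f x) ->
  (forall x, is_derive x 1 f (derive1 f x)) /\
  (forall x, is_derive x 1 (derive1 f) (derive1n 2 f x)).
Proof.
move=> fd; split=> x.
  by rewrite derive1E; have [/nbhs_singleton dfx _] := fd x;
    exact: derivableP dfx.
rewrite derive1nS derive1n1 (derive1E _ x); apply: derivableP.
by case: (fd x).
Qed.

End alternating_functions.

(** * The kernel of the linearized operator *)

Section jacobi_fields.
Context {R : realType}.
Notation mu := (@lebesgue_measure R).
Variables (eps k L : R) (u u1 : R -> R) (p : nat).
Hypothesis prf : profile eps k L u u1.
Hypothesis p0 : (0 < p)%N.
Hypothesis pL : (2 * p)%:R * L = 1.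
Implicit Types (x a c d : R) (phi v g : R -> R).

Let e0 : eps != 0. Proof. by rewrite gt_eqF// (prof_eps prf). Qed.
Let du := prof_der prf.
Let h := 2 * k - 2 * k ^+ 2.

Let hE x : u1 x ^+ 2 = (u x ^+ 4 / 2 - u x ^+ 2 + h) / eps ^+ 2.
Proof. by rewrite -(prof_energy prf) mulrC mulKf// expf_neq0. Qed.

Let h0 : 0 < h /\ 2 - 4 * h > 0.
Proof. by have /andP[a b] := prof_k prf; rewrite /h; nra. Qed.

Definition prof_u2 x := (u x ^+ 3 - u x) / eps ^+ 2.
Definition prof_u3 x := (3 * u x ^+ 2 - 1) * u1 x / eps ^+ 2.

Let du1 x : is_derive x 1 u1 (prof_u2 x) := prof_der1 prf x.

Lemma der_prof_u2 x : is_derive x 1 prof_u2 (prof_u3 x).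
Proof. by have d := du; rewrite /prof_u2 /prof_u3; der; field. Qed.

Lemma u1_0 : u1 0 != 0.
Proof.
have [h1 h2] := h0; rewrite -sqrf_eq0 hE (prof_0 prf).
rewrite mulf_neq0 ?invr_eq0 ?expf_neq0//.
by rewrite expr0n/= mul0r expr0n/= subr0 add0r gt_eqF.
Qed.

Lemma u_shift (i : int) x : u (x + i%:~R * L) = (-1) ^ i * u x.
Proof. exact: alternating_int (prof_shift prf) i x. Qed.

Lemma u1_alternating x : u1 (x + L) = - u1 x.
Proof. exact: alternating_der (prof_shift prf) du x. Qed.

Lemma u1_shift (i : int) x : u1 (x + i%:~R * L) = (-1) ^ i * u1 x.
Proof. exact: alternating_int u1_alternating i x. Qed.

Let N1 : (-1) ^ ((2 * p)%N : int) = 1 :> R.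
Proof. by rewrite -exprnP exprM sqrrN !expr1n. Qed.

Lemma u_periodic : periodic u 1.
Proof. by move=> x; rewrite -{1}pL pmulrn u_shift N1 mul1r. Qed.

Lemma u1_periodic : periodic u1 1.
Proof. by move=> x; rewrite -{1}pL pmulrn u1_shift N1 mul1r. Qed.

Lemma u_node (i : nat) : u (i%:R * L) = 0.
Proof. by rewrite -[X in u X]add0r pmulrn u_shift (prof_0 prf) mulr0. Qed.

Lemma u2_node (i : nat) : prof_u2 (i%:R * L) = 0.
Proof. by rewrite /prof_u2 u_node expr0n/= subr0 mul0r. Qed.

Lemma u1_node_sq (i : nat) : u1 (i%:R * L) ^+ 2 = u1 0 ^+ 2.
Proof. by rewrite !hE u_node (prof_0 prf). Qed.

Lemma u1_node (i : nat) : u1 (i%:R * L) != 0.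
Proof. by rewrite -sqrf_eq0 u1_node_sq sqrf_eq0 u1_0. Qed.

Lemma u2pE up : (forall x, x \in `[0, L] -> up x = u x) -> u2p p up = u.
Proof.
move=> upE; apply/funext => x; rewrite /u2p.
have N0 : (2 * p)%:R != 0 :> R by rewrite pnatr_eq0 muln_eq0/= -lt0n.
have LE : L = (2 * p)%:R^-1 by apply: (mulfI N0); rewrite pL divff.
set i := Num.floor _; rewrite -LE.
have /andP[i1 i2] := floor_itv (x * (2 * p)%:R); rewrite -/i in i1 i2.
have P0 : 0 < (2 * p)%:R :> R by rewrite ltr0n muln_gt0.
rewrite upE; last first.
  rewrite in_itv/= subr_ge0 LE ler_pdivrMr// i1 /=.
  rewrite lerBlDl -[X in _ + X]mul1r -mulrDl ler_pdivlMr//.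
  by rewrite ltW// -[1]/(1%:~R) -intrD.
by rewrite -u_shift subrK.
Qed.

(* Reduction of order from the Jacobi field [u1] gives a second one, [jacobi2],
   in closed form since the linearized equation is a Lame equation. *)
Definition jacZ := primitive (fun x => u x ^+ 2 - 2 * h).
Definition jacobi2 x := jacZ x * u1 x + (2 - 2 * h) * u x - u x ^+ 3.
Definition jacobi2_der x := (2 - 4 * h - 2 * u x ^+ 2) * u1 x + jacZ x *
  prof_u2 x.

Let jacZP : jacZ 0 = 0 /\ forall x, is_derive x 1 jacZ (u x ^+ 2 - 2 * h).
Proof.
apply: primitiveP; have d := du.
by apply: (@der_continuous R _ (fun x => 2 * u x * u1 x)) => x; der; ring.
Qed.
Let jacZ0 := jacZP.1.
Let djacZ := jacZP.2.

Lemma der_jacobi2 x : is_derive x 1 jacobi2 (jacobi2_der x).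
Proof.
have d := du; have d1 := du1; have dZ := djacZ.
by rewrite /jacobi2 /jacobi2_der; der; ring.
Qed.

Lemma der_jacobi2_der x :
  is_derive x 1 jacobi2_der ((3 * u x ^+ 2 - 1) * jacobi2 x / eps ^+ 2).
Proof.
have d := du; have d1 := du1; have d2 := der_prof_u2; have dZ := djacZ.
rewrite /jacobi2 /jacobi2_der; der.
(* The terms are regrouped so that the first integral [hE] can trade [u1 ^+ 2] for a polynomial in
   [u], after which the identity is algebraic. *)
rewrite (_ : _ + _ + _ = - 4 * u x * u1 x ^+ 2 + (2 - 4 * h - 2 * u x ^+ 2) *
  prof_u2 x +
   (u x ^+ 2 - 2 * h) * prof_u2 x + jacZ x * prof_u3 x); last by ring.
by rewrite hE /prof_u2 /prof_u3; field.
Qed.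

Lemma jacZ_shift x : jacZ (x + L) = jacZ x + jacZ L.
Proof.
have dZ := djacZ.
have d (y : R) : is_derive y 1 (fun y => jacZ (y + L) - jacZ y) 0.
  by der; rewrite (prof_shift prf); ring.
by have := @is_derive_0_is_cst R _ x 0 d; rewrite /= add0r jacZ0 subr0 => <-;
  ring.
Qed.

Lemma jacZ_node (i : nat) x : jacZ (x + i%:R * L) = jacZ x + i%:R * jacZ L.
Proof.
elim: i => [|i ih]; first by rewrite !mul0r !addr0.
by rewrite mulrSr !mulrDl !mul1r addrA jacZ_shift ih; ring.
Qed.

Lemma jacZL_lt0 : jacZ L < 0.
Proof.
have dZ := djacZ.
have d (x : R) : is_derive x 1 (fun x => - jacZ x) (2 * h - u x ^+ 2) by der;
  ring.
rewrite -oppr_gt0 -oppr0 -[X in - X < _]jacZ0.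
apply: der_increasing (prof_L prf) d _ => x _; rewrite subr_gt0.
(* [u^2 <= 2 k < 2 h], since [2 h - 2 k = 2 k (1 - 2 k)]. *)
have /andP[a b] := prof_k prf.
by apply: le_lt_trans (prof_le prf x) _; rewrite /h; nra.
Qed.

(** At the nodes only [jacZ * u1] survives, and [jacZ] grows by [jacZ L] per cell. Relative to [u1]
    the nodal values are thus linear in [i], which allows interpolation between prescribed node
    speeds. *)
Lemma jacobi2_node (i : nat) : jacobi2 (i%:R * L) = i%:R * jacZ L * u1 (i%:R *
  L).
Proof.
rewrite /jacobi2 u_node -[X in jacZ X]add0r jacZ_node jacZ0 add0r.
by rewrite expr0n/= mulr0 addr0 subr0.
Qed.

Lemma jacobi2_der_node (i : nat) : jacobi2_der (i%:R * L) = (2 - 4 * h) * u1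
  (i%:R * L).
Proof. by rewrite /jacobi2_der u2_node u_node expr0n/= mulr0 mulr0 subr0 addr0.
  Qed.

Lemma jacobi2_shift x : jacobi2 (x + 1) = jacobi2 x + (2 * p)%:R * jacZ L * u1
  x.
Proof.
by rewrite /jacobi2 u_periodic u1_periodic -{1}pL jacZ_node; ring.
Qed.

Lemma jacobi_wronskian phi phi1 psi psi1 :
  (forall x, is_derive x 1 phi (phi1 x)) ->
  (forall x, is_derive x 1 phi1 ((3 * u x ^+ 2 - 1) * phi x / eps ^+ 2)) ->
  (forall x, is_derive x 1 psi (psi1 x)) ->
  (forall x, is_derive x 1 psi1 ((3 * u x ^+ 2 - 1) * psi x / eps ^+ 2)) ->
  forall x, phi1 x * psi x - phi x * psi1 x = phi1 0 * psi 0 - phi 0 * psi1 0.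
Proof.
move=> d1 d2 d3 d4 x.
have d (y : R) : is_derive y 1 (fun y => phi1 y * psi y - phi y * psi1 y) 0.
  by der; ring.
exact: (@is_derive_0_is_cst R _ x 0 d).
Qed.

Let du2' x : is_derive x 1 prof_u2 ((3 * u x ^+ 2 - 1) * u1 x / eps ^+ 2) :=
  der_prof_u2 x.

Lemma jacobi_kernelE :
  jacobi_kernel eps u = [set phi | exists c, phi = (fun x => c * u1 x)].
Proof.
apply/seteqP; split => phi.
- move=> [per td eqn].
  have [d1 d2] := twice_derivable_der td.
  have {}d2 x : is_derive x 1 (derive1 phi) ((3 * u x ^+ 2 - 1) * phi x / eps
    ^+ 2).
    apply: is_derive_eq (d2 x) _; have := eqn x; rewrite d2WE => /eqP.
    by rewrite subr_eq0 => /eqP <-; field.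
  (* Three constant Wronskians express [phi] through [u1] and [jacobi2] by Cramer's rule, in place
     of a uniqueness theorem for the equation. *)
  have WA := jacobi_wronskian d1 d2 du1 du2'.
  have WB := jacobi_wronskian d1 d2 der_jacobi2 der_jacobi2_der.
  have WK := jacobi_wronskian du1 du2' der_jacobi2 der_jacobi2_der.
  move: (_ - _) WA (_ - _) WB => A WA B WB.
  have jac0 : jacobi2 0 = 0 by have := jacobi2_node 0; rewrite !mul0r.
  have jac10 : jacobi2_der 0 = (2 - 4 * h) * u1 0 by have := jacobi2_der_node
    0; rewrite !mul0r.
  set K := _ - _ in WK.
  have K0 : K != 0.
    rewrite /K jac0 jac10 mulr0 sub0r oppr_eq0 !mulf_neq0 ?u1_0//.
    by have [_ /lt0r_neq0] := h0.
  have phiE x : phi x = (B * u1 x - A * jacobi2 x) / K.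
    rewrite -(WA x) -(WB x); apply: (mulIf K0); rewrite divfK//.
    by rewrite -(WK x); ring.
  (* Over one turn [jacobi2] picks up a nonzero multiple of [u1], so periodicity at 0 kills its
     coefficient. *)
  have A0 : A = 0.
    have := per 0; rewrite !phiE u1_periodic jacobi2_shift => /(divIf K0).
    move=> e; have : A * ((2 * p)%:R * jacZ L * u1 0) = 0 by move: e; lra.
    move/eqP; rewrite !mulf_eq0 pnatr_eq0 muln_eq0/= (negbTE u1_0).
    by rewrite (lt_eqF jacZL_lt0) (gtn_eqF p0) !orbF => /eqP.
  by exists (B / K); apply/funext => x; rewrite phiE A0; ring.
move=> [c ->].
have dc x : is_derive x 1 (fun x => c * u1 x) (c * prof_u2 x).
  by have d := du1; der; ring.
have dc1 x : is_derive x 1 (fun x => c * prof_u2 x) (c * prof_u3 x).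
  by have d := der_prof_u2; der; ring.
have td := twice_derP dc dc1.
split; first by move=> x; rewrite u1_periodic.
  by move=> x; case: (td x).
by move=> x; rewrite (td x).2 d2WE /prof_u3; field.
Qed.

Lemma jacobi_nullity : nullity eps u 1.
Proof.
exists (fun _ => u1); split.
  move=> c /(congr1 (fun f => f 0)); rewrite /lin_comb big_ord1 /= => /eqP.
  rewrite mulf_eq0 (negbTE u1_0) orbF => /eqP c0 i.
  by rewrite (ord1 i).
rewrite jacobi_kernelE; apply/seteqP; split => phi.
  move=> [c ->]; exists (fun=> c) => //.
  by apply/funext => x; rewrite /lin_comb big_ord1.
move=> [c _ <-]; exists (c ord0).
by apply/funext => x; rewrite /lin_comb big_ord1.
Qed.

End jacobi_fields.

(** * Morse index *)

Section gluing.
Context {R : realType}.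
Notation mu := (@lebesgue_measure R).
Implicit Types (f g h u v H : R -> R) (x a b c d : R).

Lemma intg_eq_left a b f g : intg a b f -> (forall x, a < x <= b -> f x = g x)
  ->
  intg a b g /\ \int[mu]_(x in `[a, b]) g x = \int[mu]_(x in `[a, b]) f x.
Proof.
move=> fi fg.
have fi' : mu.-integrable `]a, b] (EFin \o f).
  by apply: integrableS fi => //; exact: subset_itv_oc_cc.
have fgab : {in `]a, b]%classic, EFin \o f =1 EFin \o g}.
  by move=> x; rewrite inE /= in_itv/= => /fg ->.
have gi' : mu.-integrable `]a, b] (EFin \o g).
  apply: eq_integrable fi' => //.
have gi : intg a b g.
  have /integrableP[mg lg] := gi'.
  have mg' : measurable_fun `[a, b] g.
    by apply/measurable_fun_itv_obnd_cbndP/measurable_EFinP.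
  apply/integrableP; split; first exact/measurable_EFinP.
  rewrite -integral_itv_obnd_cbnd//.
  exact: measurableT_comp.
split => //; rewrite -[LHS]Rintegral_itv_obnd_cbnd//
  -[RHS]Rintegral_itv_obnd_cbnd//.
by apply: eq_Rintegral => x; rewrite inE /= in_itv/= => /fg.
Qed.

Lemma wd_eq_left a b u g g' : is_wderiv a b u g ->
  (forall x, a < x <= b -> g x = g' x) -> is_wderiv a b u g'.
Proof.
move=> ug gg'; have sg := wd_sqint ug; have [mg ig ue] := ug.
have [ig' _] := intg_eq_left (sqint_intg sg) gg'.
have g2 x : a < x <= b -> g x ^+ 2 = g' x ^+ 2 by move=> /gg' ->.
have [ig2 _] := intg_eq_left sg.2 g2.
split; [exact: intg_measurable ig'|exact: ig2|].
move=> x xab; rewrite (ue x xab).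
move: xab; rewrite in_itv/= => /andP[ax xb].
have [|_ ->//] := @intg_eq_left a x g g' (intgS (lexx _) xb (sqint_intg sg)).
by move=> y /andP[ay yx]; rewrite gg'// ay (le_trans yx).
Qed.

(** At the junction [b] the glued derivative takes the value of [g1], so on the right piece it
    agrees with [g2] only off the left endpoint; [wd_eq_left] absorbs this null set. *)
Lemma wd_glue_quadratic a b c u g1 g2 (e : R) H : a <= b -> b <= c ->
  is_wderiv a b u g1 -> is_wderiv b c u g2 -> cont a c H ->
  exists2 g, is_wderiv a c u g &
    \int[mu]_(x in `[a, c]) (e * g x ^+ 2 + H x) =
    \int[mu]_(x in `[a, b]) (e * g1 x ^+ 2 + H x) +
    \int[mu]_(x in `[b, c]) (e * g2 x ^+ 2 + H x).
Proof.
move=> ab bc ug1 ug2 cH; pose g x := if x <= b then g1 x else g2 x.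
have w1 : is_wderiv a b u g.
  apply: (wd_eq_left ug1) => x /andP[_ xb].
  by rewrite /g xb.
have w2 : is_wderiv b c u g.
  apply: (wd_eq_left ug2) => x /andP[bx _].
  by rewrite /g leNgt bx.
have w : is_wderiv a c u g := wd_glue ab bc w1 w2.
exists g => //.
rewrite (Rintegral_chasles ab bc); last first.
  by apply: intgD; [apply: intgZ; case: (wd_sqint w)|exact: intg_cont].
have cH1 : measurable_fun `[a, b] H.
  exact: intg_measurable (intg_cont (contS (lexx _) bc cH)).
have cH2 : measurable_fun `[b, c] H.
  exact: intg_measurable (intg_cont (contS ab (lexx _) cH)).
by rewrite (wd_unique_Rint e w1 ug1 cH1) (wd_unique_Rint e w2 ug2 cH2).
Qed.

End gluing.

(** * Upper and lower bounds for the index *)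

Section index_computation.
Context {R : realType}.
Notation mu := (@lebesgue_measure R).
Variables (eps k L : R) (u u1 : R -> R) (p : nat).
Hypothesis prf : profile eps k L u u1.
Hypothesis p0 : (0 < p)%N.
Hypothesis pL : (2 * p)%:R * L = 1.
Implicit Types (x a c d : R) (phi v g : R -> R) (F : nat -> R).

Let e0 : eps != 0. Proof. by rewrite gt_eqF// (prof_eps prf). Qed.
Let ePos : 0 < eps := prof_eps prf.
Let L0 : 0 < L := prof_L prf.
Let du := prof_der prf.
Let h := 2 * k - 2 * k ^+ 2.
Let u2 := prof_u2 eps u.
Let u3 := prof_u3 eps u u1.
Let jac := jacobi2 k u u1.
Let jac1 := jacobi2_der eps k u u1.
Let z := jacZ k u L.

Let cu a b : cont a b u.
Proof. exact/cont_continuous/(prof_cont prf). Qed.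
Arguments cu : clear implicits.

Let cpot a b phi : cont a b phi ->
  cont a b (fun x => eps^-1 * (3 * u x ^+ 2 - 1) * phi x ^+ 2).
Proof.
move=> cphi; apply: contM; last exact: contX.
apply: (contM (contC _ _ _)); apply: contD; last exact: contC.
by apply: (contM (contC _ _ _)); exact: contX.
Qed.

Let nodeS (i : nat) : i%:R * L + L = i.+1%:R * L.
Proof. by rewrite mulrSr mulrDl mul1r. Qed.

Let node_le (i j : nat) : (i <= j)%N -> i%:R * L <= j%:R * L.
Proof. by move=> ij; rewrite ler_pM2r// ler_nat. Qed.

Let node_lt (i : nat) : i%:R * L < i.+1%:R * L.
Proof. by rewrite ltr_pM2r// ltr_nat. Qed.

Let node_ge0 (i : nat) : 0 <= i%:R * L.
Proof. by rewrite mulr_ge0// ltW. Qed.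

Lemma u_sq_shift (i : nat) x : u (x - i%:R * L) ^+ 2 = u x ^+ 2.
Proof.
have := u_shift prf i (x - i%:R * L); rewrite -pmulrn subrK => ->.
by rewrite exprMn -exprnP -exprM mulnC exprM sqrrN !expr1n mul1r.
Qed.

Let Jac phi g x := g x ^+ 2 + (u x ^+ 2 - 1) / eps ^+ 2 * phi x ^+ 2.

Lemma cells_nonneg phi g : is_wderiv 0 1 phi g ->
  (forall i, (i <= 2 * p)%N -> phi (i%:R * L) = 0) ->
  forall n, (n <= 2 * p)%N -> 0 <= \int[mu]_(x in `[0, n%:R * L]) Jac phi g x.
Proof.
move=> pg phi0; elim=> [|n ih] np;
  first by rewrite mul0r set_itv1 Rintegral_set1.
have np' := ltnW np.
have le1 (i : nat) : (i <= 2 * p)%N -> i%:R * L <= 1.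
  by move=> ip; rewrite -[leRHS]pL node_le.
have ln := node_le (leqnSn n).
have cphi := wd_cont (ler01) pg.
have cJ : cont 0 1 (fun x => (u x ^+ 2 - 1) / eps ^+ 2 * phi x ^+ 2).
  apply: contM; last exact: contX.
  apply: contM; last exact: contC.
  by apply: contD; [exact: contX|exact: contC].
have iJ : intg 0 (n.+1%:R * L) (Jac phi g).
  apply: (intgS (lexx 0) (le1 _ np)); apply: intgD; last exact: intg_cont.
  by case: (wd_sqint pg).
rewrite (Rintegral_chasles (node_ge0 n) ln iJ) addr_ge0 ?ih//.
have pgn := wdS pg (node_ge0 n) (le1 _ np).
rewrite -nodeS in pgn *.
have := profile_picone prf pgn (phi0 _ np').
rewrite nodeS => /(_ (phi0 _ np)).
by under eq_Rintegral do rewrite u_sq_shift.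
Qed.

(** [3 u^2 - 1 = (u^2 - 1) + 2 u^2]: the first part yields the Picone form, nonnegative on each
    cell, and the second a nonnegative term. *)
Lemma second_variation_nonneg phi g : is_wderiv 0 1 phi g ->
  (forall i, (i <= 2 * p)%N -> phi (i%:R * L) = 0) ->
  0 <= second_variation eps u phi.
Proof.
move=> pg phi0; rewrite (second_variationE _ (cu 0 1) pg).
have cphi := wd_cont (ler01) pg.
have := cells_nonneg pg phi0 (leqnn _); rewrite pL => hJ.
have cJ : cont 0 1 (fun x => (u x ^+ 2 - 1) / eps ^+ 2 * phi x ^+ 2).
  apply: contM; last exact: contX.
  apply: contM; last exact: contC.
  by apply: contD; [exact: contX|exact: contC].
have iJ : intg 0 1 (Jac phi g).
  by apply: intgD; [case: (wd_sqint pg)|exact: intg_cont].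
have iup : intg 0 1 (fun x => 2 / eps * (u x ^+ 2 * phi x ^+ 2)).
  by apply: intgZ; apply: intg_cont; apply: contM; exact: contX.
rewrite (@eq_Rint _ _ _ _ (fun x => eps * Jac phi g x + 2 / eps * (u x ^+ 2 *
  phi x ^+ 2))).
  rewrite RintD//; last exact: intgZ.
  rewrite RintZ// addr_ge0//; first by rewrite mulr_ge0// ltW.
  apply: Rintegral_ge0 => x _; apply: mulr_ge0; first by rewrite divr_ge0// ltW.
  by apply: mulr_ge0; exact: sqr_ge0.
by move=> x _; rewrite /Jac; field.
Qed.

(* [u1] lies in the kernel of the second variation. *)
Lemma second_variation_translate v g d : is_wderiv 0 1 v g ->
  second_variation eps u (fun x => v x + d * u1 x) = second_variation eps u v.
Proof.
move=> vg.
have dd x : is_derive x 1 (fun x => d * u1 x) (d * u2 x).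
  by have d1 := prof_der1 prf; der; rewrite /u2 /prof_u2; ring.
have cu2 : continuous u2 by exact: (der_continuous (der_prof_u2 prf)).
have cdu2 : continuous (fun x => d * u2 x).
  by move=> x; apply: cvgM; [exact: cvg_cst|exact: cu2].
have w1 := wd_C1 0 1 dd cdu2.
have cu3 : continuous u3.
  apply: (@derivable_continuous_fun R) => x; have d1 := prof_der1 prf.
  have d0 := du; eexists; rewrite /u3 /prof_u3; repeat der1.
have w2 : is_wderiv 0 1 u2 u3 := wd_C1 0 1 (der_prof_u2 prf) cu3.
(* The second variation changes by [eps] times the integral of [((2 d v + d^2 u1) u2)'], and [u2]
   vanishes at 0 and 1. *)
have wy := wdD (wdZ 2 (wdZ d vg)) (wdZ d w1).
have := wd_mul ler01 wy w2.
set K := (X in is_wderiv 0 1 _ X) => wP.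
rewrite (second_variationE _ (cu 0 1) (wdD vg w1)).
rewrite (second_variationE _ (cu 0 1) vg).
have cv := wd_cont ler01 vg.
have iv : intg 0 1 (fun x => eps * g x ^+ 2 + eps^-1 * (3 * u x ^+ 2 - 1) * v x
  ^+ 2).
  apply: intgD; last by apply: intg_cont; exact: cpot.
  by apply: intgZ; case: (wd_sqint vg).
have := wd_incr wP (lexx 0) ler01 (lexx 1).
have u20 : u2 0 = 0 by have := u2_node prf 0; rewrite mul0r.
have u21 : u2 1 = 0 by have := u2_node prf (2 * p); rewrite pL.
rewrite u20 u21 !mulr0 subrr => hK.
have iK : intg 0 1 K := sqint_intg (wd_sqint wP).
apply: (@etrans _ _ (_ + eps * \int[mu]_(x in `[0, 1]) K x)); last first.
  by rewrite -hK mulr0 addr0.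
rewrite -RintZ// -RintD//; last exact: intgZ.
apply: eq_Rint => x _; rewrite /K /u2 /u3 /prof_u3 /prof_u2; field.
by rewrite e0.
Qed.

Lemma nontrivial_combination m n (A : 'M[R]_(m, n)) : (n < m)%N ->
  exists2 c : 'I_m -> R, (exists i, c i != 0) &
    forall j, \sum_(i < m) c i * A i j = 0.
Proof.
move=> nm; have : kermx A != 0.
  rewrite -mxrank_eq0 mxrank_ker subn_eq0 -ltnNge.
  exact: leq_ltn_trans (rank_leq_col A) nm.
move=> /rowV0Pn[v vA v0]; exists (fun i => v 0 i).
  by move: v0 => /rV0Pn.
move=> j; move/sub_kermxP: vA => /matrixP/(_ 0 j).
by rewrite !mxE.
Qed.

Lemma morse_index_le V m : V `<=` @W12_circle R -> negative_definite eps u V ->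
  has_dim V m -> (m <= 2 * p - 1)%N.
Proof.
move=> VW Vneg [b [bfree VE]]; rewrite leqNgt; apply/negP => hm.
have {}hm : (2 * p < m.+1)%N.
  by move: hm; rewrite ltn_subLR ?muln_gt0//; rewrite add1n ltnS.
(* With [u1] adjoined there are [m + 1 > 2 p] functions against [2 p] nodal conditions. *)
pose bu (i : 'I_m.+1) := if unlift ord0 i is Some j then b j else u1.
pose A : 'M[R]_(m.+1, 2 * p) := \matrix_(i, j) bu i (j%:R * L).
have [c [i0 ci0] hc] := nontrivial_combination A hm.
pose v := lin_comb b (fun i => c (lift ord0 i)).
have vV : V v by rewrite VE; exists (fun i => c (lift ord0 i)).
have [vper [g vg]] := VW _ vV.
have phiE x : \sum_(i < m.+1) c i * bu i x = v x + c ord0 * u1 x.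
  rewrite big_ord_recl addrC /bu unlift_none; congr (_ + _).
  by apply: eq_bigr => i _; rewrite liftK.
pose phi x := v x + c ord0 * u1 x.
have phi_node i : (i <= 2 * p)%N -> phi (i%:R * L) = 0.
  have hlt (j : nat) : (j < 2 * p)%N -> phi (j%:R * L) = 0.
    move=> jp; rewrite /phi -phiE -[RHS](hc (Ordinal jp)).
    by apply: eq_bigr => i' _; rewrite mxE.
  rewrite leq_eqVlt => /predU1P[->|]; last exact: hlt.
  (* The node of index [2 * p] is the point 1, which periodicity identifies with node 0. *)
  have := hlt 0%N; rewrite muln_gt0 p0 mul0r => /(_ isT).
  have := vper 0; have := u1_periodic prf pL 0; rewrite !add0r => u10 v10.
  by rewrite pL /phi v10 u10.
have d1 := prof_der1 prf.
have cu2 : continuous u2 by exact: (der_continuous (der_prof_u2 prf)).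
have wphi := wdD vg (wdZ (c ord0) (wd_C1 0 1 d1 cu2)).
have := second_variation_nonneg wphi phi_node.
rewrite (second_variation_translate _ vg) leNgt => /negP; apply.
(* It remains to exclude [v = 0]: then freeness of [b] and [u1 0 != 0] make every coefficient
   vanish. *)
apply: Vneg => // v0.
have c_lift i : c (lift ord0 i) = 0 by apply: (bfree _ v0).
have c_0 : c ord0 = 0.
  have := phi_node 0%N (leq0n _); rewrite mul0r /phi v0 add0r => /eqP.
  by rewrite mulf_eq0 (negbTE (u1_0 prf)) orbF => /eqP.
move: ci0; case: (unliftP ord0 i0) => [j ->|->]; rewrite ?c_lift ?c_0 eqxx//.
Qed.

Let du1 := prof_der1 prf.
Let djac := der_jacobi2 prf.
Let djac1 := der_jacobi2_der prf.
Let z0 : z < 0 := jacZL_lt0 prf.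
Let zN : z != 0. Proof. by rewrite lt_eqF. Qed.

(* On the cell [i L, (i + 1) L] this is the Jacobi field that moves the node
   [j L] with speed proportional to [F j], for [j = i, i + 1]. *)
Definition cell_field F (i : nat) x :=
  F i * (u1 x - (jac x - i%:R * z * u1 x) / z) +
  F i.+1 * ((jac x - i%:R * z * u1 x) / z).

Definition cell_field_der F (i : nat) x :=
  F i * (u2 x - (jac1 x - i%:R * z * u2 x) / z) +
  F i.+1 * ((jac1 x - i%:R * z * u2 x) / z).

Lemma der_cell_field F i x :
  is_derive x 1 (cell_field F i) (cell_field_der F i x).
Proof.
have [d1 [dj dj1]] := (du1, (djac, djac1)).
by rewrite /cell_field /cell_field_der; der; rewrite /jac1 /u2 /prof_u2;
  field; rewrite ?zN ?e0.
Qed.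

Lemma der_cell_field_der F i x : is_derive x 1 (cell_field_der F i)
  ((3 * u x ^+ 2 - 1) * cell_field F i x / eps ^+ 2).
Proof.
have [d2 [dj dj1]] := (der_prof_u2 prf, (djac, djac1)).
by rewrite /cell_field /cell_field_der; der; rewrite /jac /prof_u3; field;
  rewrite ?zN ?e0.
Qed.

Lemma cell_fieldl F i : cell_field F i (i%:R * L) = F i * u1 (i%:R * L).
Proof. by rewrite /cell_field /jac (jacobi2_node prf) -/z; field. Qed.

Lemma cell_fieldr F i :
  cell_field F i (i.+1%:R * L) = F i.+1 * u1 (i.+1%:R * L).
Proof. by rewrite /cell_field /jac (jacobi2_node prf) -/z mulrSr; field. Qed.

Lemma cell_field_der_node F i (j : nat) : cell_field_der F i (j%:R * L) =
  (F i.+1 - F i) / z * (2 - 4 * h) * u1 (j%:R * L).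
Proof.
by rewrite /cell_field_der /jac1 (jacobi2_der_node prf) /u2 (u2_node prf) -/h;
  field.
Qed.

(** The constant [c] of the overview. Its sign is that of [z], as [2 - 4 h = 2 (1 - 2 k)^2]. *)
Let rate := eps * (2 - 4 * h) / z * u1 0 ^+ 2.

Lemma rate_lt0 : rate < 0.
Proof.
rewrite /rate pmulr_llt0; last by rewrite exprn_even_gt0//= (u1_0 prf).
rewrite pmulr_rlt0 ?invr_lt0// mulr_gt0//.
by have /andP[a b] := prof_k prf; rewrite /h; nra.
Qed.

Let integrand phi g x := eps * g x ^+ 2 + eps^-1 * (3 * u x ^+ 2 - 1) * phi x
  ^+ 2.

(** For a Jacobi field [phi] the integrand is [(eps phi phi')']. The boundary terms combine into a
    square because [u1 ^+ 2] has the same value at all nodes. *)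
Lemma cell_field_energy F i :
  \int[mu]_(x in `[i%:R * L, i.+1%:R * L])
     integrand (cell_field F i) (cell_field_der F i) x =
  rate * (F i.+1 - F i) ^+ 2.
Proof.
have dc := der_cell_field F i; have dc1 := der_cell_field_der F i.
have d x : is_derive x 1
    (fun x => eps * (cell_field F i x * cell_field_der F i x))
    (integrand (cell_field F i) (cell_field_der F i) x).
  by der; rewrite /integrand; field.
have ci : continuous (integrand (cell_field F i) (cell_field_der F i)).
  apply: derivable_continuous_fun => x; have d0 := du.
  by eexists; rewrite /integrand; repeat der1.
rewrite (FTC (node_le (leqnSn i)) d ci) cell_fieldl cell_fieldr.
rewrite !cell_field_der_node /rate -(u1_node_sq prf i).
transitivity (eps * (2 - 4 * h) / z * ((F i.+1 - F i) * F i.+1 * u1 (i.+1%:R *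
  L) ^+ 2 -
   (F i.+1 - F i) * F i * u1 (i%:R * L) ^+ 2)); first by ring.
by rewrite !(u1_node_sq prf); ring.
Qed.

(** The fractional part makes it periodic by construction; a node is evaluated with the cell on its
    right. *)
Definition broken_field F x :=
  let y := x - (Num.floor x)%:~R in
  cell_field F (Num.truncn (y * (2 * p)%:R)) y.

Lemma broken_field_periodic F : periodic (broken_field F) 1.
Proof.
by move=> x; rewrite /broken_field floorDrz ?floor1// intrD; congr cell_field;
  try (congr Num.truncn); ring.
Qed.

Let N0 : 0 < (2 * p)%:R :> R. Proof. by rewrite ltr0n muln_gt0. Qed.
Let node1 (i : nat) : (i <= 2 * p)%N -> i%:R * L <= 1.
Proof. by move=> ip; rewrite -[leRHS]pL node_le. Qed.

Lemma broken_fieldE F (i : nat) x : (i < 2 * p)%N ->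
  i%:R * L <= x < i.+1%:R * L -> broken_field F x = cell_field F i x.
Proof.
move=> ip /andP[ix xi].
have x0 : 0 <= x := le_trans (node_ge0 i) ix.
have x1 : x < 1 := lt_le_trans xi (node1 ip).
have -> : broken_field F x = cell_field F (Num.truncn (x * (2 * p)%:R)) x.
  rewrite /broken_field (_ : Num.floor x = 0) ?subr0//.
  by apply: floor_def; rewrite x0.
congr cell_field; apply: truncn_def.
have LN : L * (2 * p)%:R = 1 by rewrite mulrC.
have := ix; have := xi.
rewrite -(ltr_pM2r N0) -mulrA LN mulr1 => ->.
by rewrite -(ler_pM2r N0) -mulrA LN mulr1 => ->.
Qed.

(** The right end of a cell is evaluated by the next cell, and for the last cell by the first one
    through periodicity; there both values are 0. *)
Lemma broken_field_cell F (i : nat) x : F 0%N = 0 -> F (2 * p)%N = 0 ->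
  (i < 2 * p)%N -> i%:R * L <= x <= i.+1%:R * L ->
  broken_field F x = cell_field F i x.
Proof.
move=> F0 F2 ip /andP[ix]; rewrite le_eqVlt => /predU1P[->|xi]; last first.
  by apply: broken_fieldE => //; rewrite ix.
rewrite cell_fieldr; move: (ip); rewrite leq_eqVlt => /predU1P[->|ip'].
  rewrite F2 mul0r pL -[X in broken_field F X]add0r broken_field_periodic.
  rewrite (@broken_fieldE _ 0) ?muln_gt0//; last by rewrite mul0r lexx mul1r.
  by have := cell_fieldl F 0; rewrite mul0r F0 mul0r.
by rewrite (@broken_fieldE _ i.+1)// ?cell_fieldl// lexx node_lt.
Qed.

Lemma broken_field_energy F n : F 0%N = 0 -> F (2 * p)%N = 0 ->
  (n <= 2 * p)%N ->
  exists2 g, is_wderiv 0 (n%:R * L) (broken_field F) g &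
    \int[mu]_(x in `[0, n%:R * L]) integrand (broken_field F) g x =
    rate * \sum_(i < n) (F i.+1 - F i) ^+ 2.
Proof.
move=> F0 F2; elim: n => [|n ih] np.
  rewrite mul0r; exists (cst 0);
    last by rewrite set_itv1 Rintegral_set1 big_ord0 mulr0.
  apply: (@wd_eq _ _ _ (fun=> broken_field F 0)) => //.
    by move=> x; rewrite in_itv/= -eq_le => /eqP <-.
  exact: (wd_C1 0 0 (fun x => derC _ x) (@cst_continuous _ _ _)).
have [g wg Eg] := ih (ltnW np).
have wc : is_wderiv (n%:R * L) (n.+1%:R * L) (broken_field F) (cell_field_der F
  n).
  apply: (@wd_eq _ _ _ (cell_field F n)); last first.
  - apply: wd_C1; first exact: der_cell_field.
    exact: (der_continuous (der_cell_field_der F n)).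
  - exact: node_le.
  by move=> x; rewrite in_itv/= => xn; rewrite (@broken_field_cell F n).
have n0 := node_ge0 n; have n1 := node_le (leqnSn n).
have cb : cont 0 (n.+1%:R * L) (broken_field F).
  (* This gluing with [H = 0] only provides the continuity that the second gluing needs for its
     potential term. *)
  have [g' wg' _] := wd_glue_quadratic 0 n0 n1 wg wc (contC 0 _ 0).
  exact: (wd_cont (le_trans n0 n1) wg').
have [g' wg' Eg'] := wd_glue_quadratic eps n0 n1 wg wc (cpot cb).
exists g' => //; rewrite [LHS]Eg' [X in X + _]Eg big_ord_recr /= mulrDr.
congr (_ + _); rewrite -cell_field_energy.
by apply: eq_Rint => x; rewrite in_itv/= => xn;
  rewrite /integrand (@broken_field_cell F n).
Qed.

(** The index shift pins node 0, which removes the rotation, where the second variation is zero. *)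
Let shift_coeffs (c : 'I_(2 * p - 1) -> R) (i : nat) : R :=
  \sum_(j < 2 * p - 1) c j * (i == j.+1)%:R.

Lemma morse_index_ge : exists V, [/\ V `<=` @W12_circle R,
  negative_definite eps u V & has_dim V (2 * p - 1)].
Proof.
pose b (j : 'I_(2 * p - 1)) := broken_field (fun i => (i == j.+1)%:R).
have bE (c : 'I_(2 * p - 1) -> R) : lin_comb b c = broken_field (shift_coeffs
  c).
  apply/funext => x; rewrite /lin_comb /b /broken_field /cell_field
    /shift_coeffs.
  rewrite !mulr_suml -big_split /=; apply: eq_bigr => j _; ring.
have s0 (c : 'I_(2 * p - 1) -> R) : shift_coeffs c 0 = 0.
  by apply: big1 => j _; rewrite mulr0.
have s2 (c : 'I_(2 * p - 1) -> R) : shift_coeffs c (2 * p) = 0.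
  apply: big1 => j _; case: eqP => [e|]; last by rewrite mulr0.
  by have := ltn_ord j; rewrite ltn_subRL add1n -e ltnn.
have sE (c : 'I_(2 * p - 1) -> R) (j : 'I_(2 * p - 1)) : shift_coeffs c j.+1 =
  c j.
  rewrite /shift_coeffs (bigD1 j)//= eqxx mulr1 big1 ?addr0// => i ij.
  rewrite eqSS; case: eqP => [e|]; last by rewrite mulr0.
  by case/eqP: ij; exact/val_inj/esym.
have jlt (j : 'I_(2 * p - 1)) : (j.+1 < 2 * p)%N.
  by have := ltn_ord j; rewrite ltn_subRL.
exists (range (lin_comb b)); split.
- move=> _ [c _ <-]; rewrite bE; split; first exact: broken_field_periodic.
  have [g wg _] := broken_field_energy (s0 c) (s2 c) (leqnn _).
  by rewrite pL in wg; exists g.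
- move=> _ [c _ <-]; rewrite bE => nz.
  have [g wg] := broken_field_energy (s0 c) (s2 c) (leqnn _).
  rewrite pL in wg *; rewrite (second_variationE _ (cu 0 1) wg) => ->.
  rewrite nmulr_rlt0 ?rate_lt0// lt_neqAle sumr_ge0 ?andbT; last first.
    by move=> i _; exact: sqr_ge0.
  apply/negP; rewrite eq_sym psumr_eq0; last by move=> i _; exact: sqr_ge0.
  move=> /allP hF.
  have F0 (i : nat) : (i <= 2 * p)%N -> shift_coeffs c i = 0.
    elim: i => [|i ih] ip; first exact: s0.
    have := hF (Ordinal ip) (mem_index_enum _);
      rewrite sqrf_eq0 subr_eq0 /= => /eqP ->.
    exact: ih (ltnW ip).
  apply: nz; rewrite -bE; apply/funext => x; rewrite /lin_comb big1// => j _.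
  by rewrite -sE F0 ?mul0r// ltnW.
- exists b; split => // c; rewrite bE => e j.
  (* Evaluation at node [j + 1] isolates [c j], because [u1] does not vanish there. *)
  have := congr1 (fun f => f (j.+1%:R * L)) e.
  rewrite /= (@broken_fieldE _ j.+1)//; last by rewrite lexx node_lt.
  by rewrite cell_fieldl sE => /eqP;
    rewrite mulf_eq0 (negbTE (u1_node prf _)) orbF => /eqP.
Qed.

Lemma profile_morse_index : morse_index eps u (2 * p - 1).
Proof.
by split; [exact: morse_index_ge|move=> V m VW Vneg; exact: morse_index_le].
Qed.

End index_computation.

(** * Energy as a function of the length of the interval *)

Section minimal_energy.
Context {R : realType}.
Notation mu := (@lebesgue_measure R).
Implicit Types (f g : R -> R) (x a b c d l eps k t : R).

Section profile_energy.
Variables (eps k L : R) (u u1 : R -> R).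
Hypothesis prf : profile eps k L u u1.

Let e0 : eps != 0. Proof. by rewrite gt_eqF// (prof_eps prf). Qed.
Let ePos : 0 < eps := prof_eps prf.
Let L0 : 0 < L := prof_L prf.
Let du := prof_der prf.
Let du1 := prof_der1 prf.

Let kin x := eps / 2 * u1 x ^+ 2.
Let pot x := eps^-1 * W (u x).

Let ckin : continuous kin.
Proof.
apply: derivable_continuous_fun => x; have d1 := du1.
by eexists; rewrite /kin; repeat der1.
Qed.

Let cpot : continuous pot.
Proof.
apply: derivable_continuous_fun => x; have d1 := du.
by eexists; rewrite /pot /W; repeat der1.
Qed.

Definition kinetic : R := primitive kin L.
Definition potential : R := primitive pot L.

Let pk0 : primitive kin 0 = 0 := (primitiveP ckin).1.
Let dpk : forall x, is_derive x 1 (primitive kin) (kin x) := (primitiveP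
  ckin).2.
Let pp0 : primitive pot 0 = 0 := (primitiveP cpot).1.
Let dpp : forall x, is_derive x 1 (primitive pot) (pot x) := (primitiveP
  cpot).2.

Lemma rescaled_energy a l : 0 < l ->
  energy eps a (a + l) (fun x => u ((x - a) * (L / l))) =
  kinetic * (L / l) + potential * (l / L).
Proof.
move=> l0; have lN : l != 0 by rewrite gt_eqF.
have LN : L != 0 by rewrite gt_eqF.
have al : a <= a + l by rewrite lerDl ltW.
have [d0 [d1 [dk dp]]] := (du, (du1, (dpk, dpp))).
have dv x : is_derive x 1 (fun x => u ((x - a) * (L / l)))
    (L / l * u1 ((x - a) * (L / l))) by der; ring.
have cv : continuous (fun x => L / l * u1 ((x - a) * (L / l))).
  by apply: derivable_continuous_fun => x; eexists; repeat der1.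
rewrite (energyE _ al (wd_C1 a (a + l) dv cv)).
pose F x := L / l * primitive kin ((x - a) * (L / l)) +
            l / L * primitive pot ((x - a) * (L / l)).
pose F1 x := eps / 2 * (L / l * u1 ((x - a) * (L / l))) ^+ 2 +
             eps^-1 * W (u ((x - a) * (L / l))).
have dF x : is_derive x 1 F (F1 x).
  by rewrite /F /F1; der; rewrite /kin /pot; field; rewrite ?e0 ?lN ?LN.
have cF : continuous F1.
  by apply: derivable_continuous_fun => x; eexists; rewrite /F1 /W; repeat der1.
rewrite (FTC al dF cF) /F subrr mul0r pk0 pp0 (addrC a) addrK.
by rewrite [l * _]mulrC divfK// /kinetic /potential; ring.
Qed.

Lemma profile_min_energyE a : min_energy eps a (a + L) = kinetic + potential.
Proof.
rewrite (profile_min_energy prf).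
have := rescaled_energy a L0; rewrite divff ?gt_eqF// !mulr1 => <-.
by congr energy; apply/funext => x; rewrite mulr1.
Qed.

(** The profile of length [L], stretched to [[0, l]], serves as competitor; the other profile shows
    that [min_energy] is attained there. *)
Lemma min_energy_rescaled k' l u' u1' : profile eps k' l u' u1' ->
  min_energy eps 0 l <= kinetic * (L / l) + potential * (l / L).
Proof.
move=> prf'; have l0 := prof_L prf'.
have := profile_min_energy prf' 0; rewrite add0r => ->.
have := rescaled_energy 0 l0; rewrite add0r => <-.
have [_] := profile_minimizer prf' 0; rewrite add0r; apply.
have [d0 d1] := (du, du1).
split; last 2 first.
- by rewrite subrr mul0r (prof_0 prf).
- by rewrite subr0 [l * _]mulrC divfK ?gt_eqF// (prof_L0 prf).
exists (fun x => L / l * u1 ((x - 0) * (L / l))).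
apply: wd_C1 => [x|]; first by der; ring.
by apply: derivable_continuous_fun => x; eexists; repeat der1.
Qed.

(** The potential and kinetic densities differ by the conserved quantity of the equation, which is
    constant in [x]; it reappears as [energy_slope]. *)
Lemma potential_kinetic :
  potential - kinetic = L * ((1 - 2 * k) ^+ 2 / (4 * eps)).
Proof.
have [dk dp] := (dpk, dpp).
have d (x : R) : is_derive x 1 (fun x => primitive pot x - primitive kin x -
    x * ((1 - 2 * k) ^+ 2 / (4 * eps))) 0.
  der; have := prof_energy prf x; rewrite /kin /pot /W => hx.
  rewrite (_ : eps / 2 * u1 x ^+ 2 = (eps ^+ 2 * u1 x ^+ 2) / (2 * eps));
    last first.
    by field.
  by rewrite hx; field.
have := @is_derive_0_is_cst R _ L 0 d;
  rewrite /= pk0 pp0 mul0r !subr0 /kinetic /potential.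
by move=> h; lra.
Qed.

Lemma kinetic_bounds : 0 <= kinetic <= L / (4 * eps).
Proof.
have dk := dpk.
have /andP[k0 k1] := prof_k prf.
have h1 : primitive kin 0 <= primitive kin L.
  apply: der_nondecreasing (ltW L0) dk _ => x _.
  by rewrite /kin mulr_ge0 ?sqr_ge0// divr_ge0// ltW.
have d (x : R) : is_derive x 1 (fun x => x / (4 * eps) - primitive kin x)
    ((4 * eps)^-1 - kin x) by der; ring.
have h2 : 0 / (4 * eps) - primitive kin 0 <= L / (4 * eps) - primitive kin L.
  apply: der_nondecreasing (ltW L0) d _ => x _; rewrite subr_ge0 /kin.
  (* The first integral gives [eps^2 u1^2 <= 2 k - 2 k^2 <= 1 / 2], because [u^2 <= 2 k < 1]. *)
  rewrite (_ : eps / 2 * u1 x ^+ 2 = (4 * eps)^-1 * (2 * (eps ^+ 2 * u1 x ^+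
    2))); last by field.
  rewrite ger_pMr ?invr_gt0 ?mulr_gt0// (prof_energy prf).
  have := prof_le prf x; have := sqr_ge0 (u x).
  rewrite (_ : u x ^+ 4 = u x ^+ 2 * u x ^+ 2); last by ring.
  set U := u x ^+ 2; nra.
by move: h1 h2; rewrite pk0 mul0r subr0 subr_ge0 /kinetic => -> ->.
Qed.

End profile_energy.

Section fixed_eps.
Variable eps : R.
Hypothesis e0 : 0 < eps.

Definition least_energy l : R := min_energy eps 0 l.
Definition energy_slope l : R := (1 - 2 * modulus eps l) ^+ 2 / (4 * eps).

Lemma modulus_profile l : pi * eps < l ->
  exists u u1, profile eps (modulus eps l) l u u1.
Proof.
move=> hl; have [hk e] := modulusP e0 hl.
by have := profile_exists hk e0; rewrite e.
Qed.

Lemma min_energy_translate a l : pi * eps < l ->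
  min_energy eps a (a + l) = least_energy l.
Proof.
move=> /modulus_profile[u [u1 prf]];
  rewrite (profile_min_energyE prf a) /least_energy.
by have := profile_min_energyE prf 0; rewrite add0r.
Qed.

(** The energy of the stretched profile is affine in [l'] up to [A (l' - l)^2 / (l l')], with [A]
    the kinetic part. The bounds [A <= l / (4 eps)] and [l' > pi eps] make the constant independent
    of both lengths. *)
Lemma least_energy_upper l l' : pi * eps < l -> pi * eps < l' ->
  least_energy l' - least_energy l <= (l' - l) * energy_slope l + (l' - l) ^+ 2
    / (4 * pi * eps ^+ 2).
Proof.
move=> hl hl'; have [u [u1 prf]] := modulus_profile hl.
have [u' [u1' prf']] := modulus_profile hl'.
have eN : eps != 0 by rewrite gt_eqF.
have pe : 0 < pi * eps by rewrite mulr_gt0 ?pi_gt0.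
have l0 : 0 < l := lt_trans pe hl.
have l0' : 0 < l' := lt_trans pe hl'.
have := min_energy_rescaled prf prf'.
have := profile_min_energyE prf 0; rewrite add0r -!/(least_energy _) => ->.
have := potential_kinetic prf; rewrite -/(energy_slope l).
have /andP[] := kinetic_bounds prf.
set A := kinetic _ _ _; set B := potential _ _ _ => A0 A1 AB h.
have BE_ : B = A + l * energy_slope l by lra.
have -> : (l' - l) * energy_slope l + (l' - l) ^+ 2 / (4 * pi * eps ^+ 2) =
    A * (l / l') + B * (l' / l) - (A + B) +
    (l' - l) ^+ 2 * ((4 * pi * eps ^+ 2)^-1 - A / (l * l')).
  move: (pi_gt0 R); move: (@pi R) => P P0; rewrite BE_; field.
  by rewrite ?eN ?(gt_eqF l0) ?(gt_eqF l0') ?(gt_eqF P0).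
apply: le_trans (lerB h (lexx (A + B))) _.
rewrite lerDl mulr_ge0 ?sqr_ge0// subr_ge0.
rewrite (@le_trans _ _ ((4 * eps * l')^-1))//.
  rewrite ler_pdivrMr ?mulr_gt0// (le_trans A1)// le_eqVlt; apply/orP; left.
  by apply/eqP; field; rewrite eN gt_eqF.
rewrite lef_pV2 ?posrE ?mulr_gt0 ?exprn_gt0 ?pi_gt0//.
rewrite (_ : 4 * pi * eps ^+ 2 = 4 * eps * (pi * eps)); last by ring.
by rewrite ler_pM2l ?mulr_gt0// ltW.
Qed.

(** This is [period_expansive] read for the inverse function. *)
Lemma modulus_lipschitz l l' : pi * eps < l -> pi * eps < l' ->
  `|modulus eps l' - modulus eps l| <= 2 / (pi * eps) * `|l' - l|.
Proof.
wlog ll' : l l' / modulus eps l <= modulus eps l' => [hw hl hl'|hl hl'].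
  have [|/ltW] := leP (modulus eps l) (modulus eps l') => h; first exact: hw.
  by rewrite distrC [`|l' - l|]distrC; exact: hw.
have [/andP[k0 _] e] := modulusP e0 hl.
have [/andP[_ k1] e'] := modulusP e0 hl'.
have := period_expansive k0 ll' k1.
set T := period _ in e' *; set T0 := period _ in e * => hT.
rewrite ger0_norm ?subr_ge0// mulrAC ler_pdivlMr ?mulr_gt0 ?pi_gt0//.
apply: (@le_trans _ _ (2 * (l' - l))); last by rewrite ler_pM2l// ler_norm.
have := ler_wpM2l (ltW e0) hT; rewrite mulrBr e e'; lra.
Qed.

Lemma energy_slope_lipschitz l l' : pi * eps < l -> pi * eps < l' ->
  `|energy_slope l' - energy_slope l| <= 2 / (pi * eps ^+ 2) * `|l' - l|.
Proof.
move=> hl hl'; have := modulus_lipschitz hl hl'.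
have [/andP[k0 k1] _] := modulusP e0 hl.
have [/andP[k0' k1'] _] := modulusP e0 hl'.
rewrite /energy_slope; set k := modulus _ l in k0 k1 *;
  set k' := modulus _ l' in k0' k1' *.
move=> hk; have eN : eps != 0 by rewrite gt_eqF.
rewrite (_ : _ - _ = (k' - k) * ((k' + k - 1) / eps)); last by field.
rewrite normrM (_ : 2 / (pi * eps ^+ 2) * `|l' - l| =
   2 / (pi * eps) * `|l' - l| * eps^-1); last first.
  move: (pi_gt0 R); move: (@pi R) => P P0; field.
  by rewrite ?eN ?(gt_eqF P0).
apply: ler_pM => //; rewrite normrM (gtr0_norm (x := eps^-1)) ?invr_gt0//.
apply: ler_piMl; first by rewrite invr_ge0 ltW.
by rewrite ler_norml; lra.
Qed.

(** Exchanging [l] and [l'] in the upper bound gives a lower bound, but with the slope at [l']; the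
    Lipschitz estimate moves it back to [l] at quadratic cost. *)
Lemma der_least_energy l : pi * eps < l -> is_derive l 1 least_energy
  (energy_slope l).
Proof.
move=> hl; pose C1 : R := (4 * pi * eps ^+ 2)^-1;
  pose C2 : R := 2 / (pi * eps ^+ 2).
have d0 : 0 < l - pi * eps by rewrite subr_gt0.
apply: (@is_derive_quadratic_error R least_energy l (energy_slope l) (C1 + C2)
  _ d0) => l' hd.
have hl' : pi * eps < l' by move: hd; rewrite ltr_norml => /andP[+ _]; lra.
have h1 := least_energy_upper hl hl'; have h2 := least_energy_upper hl' hl.
have h3 := energy_slope_lipschitz hl hl'.
rewrite -/C1 -/C2 in h1 h2 h3.
have C20 : 0 <= C2 by rewrite divr_ge0// mulr_ge0 ?pi_ge0// sqr_ge0.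
have h4 : `|(l' - l) * (energy_slope l' - energy_slope l)| <= C2 * (l' - l) ^+
  2.
  rewrite normrM -[X in _ <= C2 * X]real_normK ?num_real// mulrC expr2 mulrA.
  by rewrite ler_wpM2r.
have h5 : 0 <= C2 * (l' - l) ^+ 2 by rewrite mulr_ge0// sqr_ge0.
have eq1 : (l - l') ^+ 2 = (l' - l) ^+ 2 by ring.
have eq2 : (l - l') * energy_slope l' = - ((l' - l) * energy_slope l') by ring.
move: h4 h1 h2 h5; rewrite eq1 eq2 mulrBr [(C1 + C2) * _]mulrDl [_ * C1]mulrC.
move: (C2 * _) (C1 * _) (_ * energy_slope l) (_ * energy_slope l')
  (least_energy l) (least_energy l').
clear => q2 q1 a a' m m'; rewrite !ler_norml => /andP[h1 h2] h3 h4 h5.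
by apply/andP; split; lra.
Qed.

Lemma der_energy_slope l : pi * eps < l ->
  exists2 c, c < 0 & is_derive l 1 energy_slope c.
Proof.
move=> hl; have [/andP[k0 k1] _] := modulusP e0 hl.
have [c c0 dm] := der_modulus e0 hl.
exists (- (1 - 2 * modulus eps l) * c / eps).
  rewrite mulNr mulNr oppr_lt0 divr_gt0// mulr_gt0//; lra.
have eN : eps != 0 by rewrite gt_eqF.
notypeclasses refine (is_derive_eq (derM (derX 2 (derB (derC 1 l)
  (derM (derC 2 l) dm))) (derC (4 * eps)^-1 l)) _).
by rewrite /=; field.
Qed.

End fixed_eps.
End minimal_energy.

(** * Second variation of the broken energy under motion of the nodes *)

Section moving_nodes.
Context {R : realType}.
Variables (p : nat) (eps : R).
Hypothesis p0 : (0 < p)%N.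
Hypothesis e0 : 0 < eps.
Let n := (2 * p)%N.
Let L : R := n%:R^-1.
Hypothesis eL : pi * eps < L.
Variable f : 'I_n -> R.

Let gap i := f (ordS i) - f i.

Lemma next_node_gap (i : 'I_n) t :
  next_node (moved_nodes f t) i = moved_nodes f t i + (L + t * gap i).
Proof.
have N0 : n%:R != 0 :> R by rewrite pnatr_eq0 muln_eq0/= -lt0n.
rewrite /next_node /moved_nodes /gap -/n /L /=.
have := ltn_ord i; rewrite leq_eqVlt => /predU1P[e|ilt].
  (* Last index: the successor is node 0, and the 1 added by [next_node] restores the spacing
     [L]. *)
  have := congr1 (fun m => m%:R : R) e; rewrite mulrSr => iE.
  rewrite e modnn eqxx; have -> : i%:R = n%:R - 1 :> R by rewrite -iE addrK.
  by rewrite mulr0n mulr1n; field.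
by rewrite modn_small// (ltn_eqF ilt) mulr0n mulrSr; field.
Qed.

Lemma gaps_eq0_cst : (forall i, gap i = 0) -> exists c, forall i, f i = c.
Proof.
move=> g0; have n0 : (0 < n)%N by rewrite muln_gt0.
exists (f (Ordinal n0)) => -[i ip]; elim: i ip => [|i ih] ip.
  by congr f; exact: val_inj.
rewrite -(ih (ltnW ip)); apply/eqP; rewrite -subr_eq0 -(g0 (Ordinal (ltnW ip))).
rewrite /gap; apply/eqP; congr (f _ - _); apply: val_inj => /=.
by rewrite modn_small.
Qed.

Lemma der_sum (I : finType) (F dF : I -> R -> R) (x : R) :
  (forall i, is_derive x 1 (F i) (dF i x)) ->
  is_derive x 1 (fun t => \sum_i F i t) (\sum_i dF i x).
Proof.
move=> h; elim: (index_enum I) => [|i s ih].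
  rewrite big_nil; apply: (der_eqfun (derC 0 x)) => y; by rewrite big_nil.
rewrite big_cons; apply: (der_eqfun (derD (h i) ih)) => y.
by rewrite big_cons.
Qed.

Let len i t := L + t * gap i.

Lemma len_near0 : exists2 d, 0 < d &
  forall t, `|t| < d -> forall i, pi * eps < len i t.
Proof.
(* One bound for all gaps; the added 1 keeps [M] positive even if every gap is 0. *)
pose M := \sum_i `|gap i| + 1.
have M0 : 0 < M by rewrite ltr_wpDl// sumr_ge0.
exists ((L - pi * eps) / M) => [|t]; first by rewrite divr_gt0// subr_gt0.
rewrite ltr_pdivlMr// => tM i.
have gM : `|gap i| <= M.
  by rewrite /M (bigD1 i)//= -addrA lerDl addr_ge0// sumr_ge0.
have : `|t * gap i| <= `|t| * M by rewrite normrM ler_wpM2l.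
by rewrite ler_norml /len => /andP[+ _]; lra.
Qed.

(** At [t = 0] all cells have length [L], so a single [c < 0], the derivative of the slope at [L],
    multiplies the sum of the squared gaps; that sum vanishes only for constant [f]. *)
Lemma BE_second_variation : ~ (exists c, forall i, f i = c) ->
  twice_derivable (fun t => BE eps (moved_nodes f t)) 0 /\
  derive1n 2 (fun t => BE eps (moved_nodes f t)) 0 < 0.
Proof.
move=> fc; have [d d0 hd] := len_near0.
have near0 (P : R -> Prop) : (forall t, `|t| < d -> P t) -> \forall t \near 0,
  P t.
  by move=> hP; exists d => //= t; rewrite /ball_ /= add0r normrN => /hP.
pose E t := \sum_i least_energy eps (len i t).
pose E1 t := \sum_i gap i * energy_slope eps (len i t).
have BEE t : `|t| < d -> BE eps (moved_nodes f t) = E t.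
  move=> td; rewrite /BE; apply: eq_bigr => i _; rewrite next_node_gap.
  by apply: min_energy_translate => //; exact: hd.
have dlen i (t : R) : is_derive t 1 (len i) (gap i) by rewrite /len; der; ring.
have dE (t : R) : `|t| < d -> is_derive t 1 E (E1 t).
  move=> td; apply: (@der_sum _ _ (fun i t => gap i * energy_slope eps (len i
    t))) => i.
  apply: is_derive_eq (der_comp (der_least_energy e0 (hd t td i)) (dlen i t)) _.
  by rewrite mulrC.
have dBE (t : R) : `|t| < d ->
    is_derive t 1 (fun t => BE eps (moved_nodes f t)) (E1 t).
  move=> td; apply: (@near_eq_is_derive _ _ _ E); last exact: dE.
  have tn : \forall s \near t, `|s| < d.
    exists (d - `|t|) => [|s /= st]; first by rewrite /= subr_gt0.
    rewrite -[s](subKr t) (le_lt_trans (ler_normB _ _))// addrC -ltrBrDr.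
    exact: st.
  by apply: filterS tn => s sd; rewrite BEE.
have BE1 (t : R) : `|t| < d -> derive1 (fun t => BE eps (moved_nodes f t)) t =
  E1 t.
  by move=> /dBE; exact: der_derive1.
have [c c0 dc] := der_energy_slope e0 eL.
have dE1 : is_derive (0 : R) 1 E1 (\sum_i gap i ^+ 2 * c).
  apply: (@der_sum _ _ (fun i _ => gap i ^+ 2 * c)) => i.
  have dc' : is_derive (len i 0) 1 (energy_slope eps) c by rewrite /len mul0r
    addr0.
  apply: is_derive_eq (derM (derC (gap i) 0) (der_comp dc' (dlen i 0))) _.
  by ring.
have d2 : is_derive (0 : R) 1 (derive1 (fun t => BE eps (moved_nodes f t)))
    (\sum_i gap i ^+ 2 * c).
  apply: (@near_eq_is_derive _ _ _ E1).
  by apply: near0 => t td; rewrite BE1.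
split.
  split; last by case: d2.
  by apply: near0 => t /dBE[].
rewrite derive1nS derive1n1 (der_derive1 d2) -mulr_suml nmulr_llt0//.
rewrite lt_neqAle sumr_ge0 ?andbT; last by move=> i _; exact: sqr_ge0.
apply/negP; rewrite eq_sym psumr_eq0; last by move=> i _; exact: sqr_ge0.
move=> /allP hF; apply: fc; apply: gaps_eq0_cst => i.
by have := hF i (mem_index_enum _); rewrite sqrf_eq0 => /eqP.
Qed.

End moving_nodes.

Theorem mainTheorem13 (R : realType) (p : nat) (hp : (1 <= p)%N) :
  exists2 eps_p : R, 0 < eps_p &
  forall eps : R, 0 < eps -> eps < eps_p ->
  [/\ exists up : R -> R, positive_minimizer eps (1 / (2 * p)%:R) up,
      forall up : R -> R, positive_minimizer eps (1 / (2 * p)%:R) up ->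
        [/\ morse_index eps (u2p p up) (2 * p - 1)%N,
            nullity eps (u2p p up) 1 &
            jacobi_kernel eps (u2p p up) =
              [set phi | exists c : R, phi = (fun x => c * derive1 (u2p p up) x)]] &
      forall f : 'I_(2 * p) -> R,
        ~ (exists c : R, forall i, f i = c) ->
        twice_derivable (fun t => BE eps (moved_nodes f t)) 0 /\
        derive1n 2 (fun t => BE eps (moved_nodes f t)) 0 < 0].
Proof.
have N0 : 0 < (2 * p)%:R :> R by rewrite ltr0n muln_gt0.
(* Below this threshold [pi * eps < 1 / (2 p)], so a profile of half-period [1 / (2 p)] exists. *)
exists ((2 * p)%:R^-1 / pi) => [|eps e0];
  first by rewrite divr_gt0 ?invr_gt0 ?pi_gt0.
rewrite ltr_pdivlMr ?pi_gt0// mulrC => eL.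
have [u [u1 prf]] := modulus_profile e0 eL.
have pL : (2 * p)%:R * (2 * p)%:R^-1 = 1 :> R by rewrite divff ?gt_eqF.
rewrite div1r; split.
- by exists u; exact: positive_minimizer_exists prf.
- move=> up upmin.
  have -> : u2p p up = u.
    by apply: (u2pE prf hp pL); exact: (positive_minimizer_unique prf).
  have -> : derive1 u = u1.
    by apply/funext => x; exact: der_derive1 (prof_der prf x).
  split.
  + exact: (profile_morse_index prf hp pL).
  + exact: (jacobi_nullity prf hp pL).
  + exact: (jacobi_kernelE prf hp pL).
- by move=> f fc; exact: BE_second_variation.
Qed.
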